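(* Let $\Gamma$ be a finitely generated branch group. Then every commensurated subgroup of $\Gamma$ is commensurate to a normal subgroup of $\Gamma$.
   Context: Let $T$ be a locally finite rooted tree with boundary $\partial T$, and let $\Gamma$ be a group of automorphisms of $T$. For a vertex $v$, let $\partial T_v\subseteq\partial T$ be the clopen set of boundary points of the subtree below $v$, and let $\mathrm{Rist}_\Gamma(v)$ be the pointwise fixator in $\Gamma$ of $\partial T\setminus\partial T_v$. For $n\ge1$, $\mathrm{Rist}_\Gamma(n)$ is the subgroup generated by all $\mathrm{Rist}_\Gamma(v)$, $v$ ranging over vertices of level $n$. The action of $\Gamma$ on $T$ is branch if $\Gamma$ acts transitively on each level of $T$ and $\mathrm{Rist}_\Gamma(n)$ has finite index in $\Gamma$ for all $n\ge1$. A branch group is a group admitting a faithful branch action on a locally finite rooted tree. Two subgroups are commensurate if their intersection has finite index in both; a subgroup of $\Gamma$ is commensurated if all its $\Gamma$-conjugates are commensurate to one another. *)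

(* Defs.v *)
From mathcomp Require Import all_boot.
From mathcomp Require Import boolp classical_sets functions cardinality.

Set Implicit Arguments.
Unset Strict Implicit.
Unset Printing Implicit Defensive.

Local Open Scope classical_set_scope.
Local Open Scope group_scope.

(* fingroup only handles subgroups of finite groups; subgroups of the possibly
   infinite groups considered here are classical sets. *)
Definition subgroup (G : groupType) (H : set G) : Prop :=
  [/\ H 1, (forall x y, H x -> H y -> H (x * y)) & (forall x, H x -> H x^-1)].

Definition normal_subgroup (G : groupType) (N : set G) : Prop :=
  subgroup N /\ (forall x g, N x -> N (x ^ g)).

Definition generated (G : groupType) (S : set G) : set G :=
  smallest (@subgroup G) S.

Definition finitely_generated (G : groupType) : Prop :=
  exists S : set G, finite_set S /\ generated S = setT.

Definition left_coset (G : groupType) (H : set G) (x : G) : set G :=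
  [set x * h | h in H].

(* Only meaningful for subgroups H `<=` K. *)
Definition finite_index (G : groupType) (H K : set G) : Prop :=
  finite_set [set left_coset H x | x in K].

Definition commensurate (G : groupType) (H K : set G) : Prop :=
  finite_index (H `&` K) H /\ finite_index (H `&` K) K.

Definition conjugate (G : groupType) (H : set G) (g : G) : set G :=
  [set x ^ g | x in H].

Definition commensurated (G : groupType) (H : set G) : Prop :=
  forall g h : G, commensurate (conjugate H g) (conjugate H h).

(* A tree with a root is given by its parent map. By level_parent, iterating
   parent from a vertex of level n reaches level 0, i.e. the root, in exactly n
   steps: the tree is connected, level is the distance to the root, and
   parent root = root by convention. *)
Record rooted_tree : Type := RootedTree {
  vertex :> Type;
  root : vertex;
  parent : vertex -> vertex;
  level : vertex -> nat;
  level_eq0 : forall v, level v = 0%N <-> v = root;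
  level_parent : forall v, level (parent v) = (level v).-1 }.

Arguments root {_}.
Arguments parent {_}.
Arguments level {_}.

Definition locally_finite (T : rooted_tree) : Prop :=
  forall v : T, finite_set [set w : T | parent w = v].

(* Boundary points are the infinite rays from the root, listed by level. *)
Definition boundary (T : rooted_tree) : set (nat -> T) :=
  [set x | x 0%N = root /\
           forall n, level (x n.+1) = n.+1 /\ parent (x n.+1) = x n].

(* The boundary points of the subtree below v. *)
Definition boundary_below (T : rooted_tree) (v : T) : set (nat -> T) :=
  [set x | boundary x /\ exists n, x n = v].

(* Since parent root = root, commuting with parent includes fixing the root. *)
Definition tree_automorphism (T : rooted_tree) (f : T -> T) : Prop :=
  bijective f /\ forall v, f (parent v) = parent (f v).

Record tree_action (G : groupType) (T : rooted_tree) : Type := TreeAction {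
  act :> G -> T -> T;
  act_automorphism : forall g, tree_automorphism (act g);
  act1 : forall v, act 1 v = v;
  actM : forall g h v, act (g * h) v = act g (act h v) }.

Definition faithful_action (G : groupType) (T : rooted_tree)
    (a : tree_action G T) : Prop :=
  injective a.

Section RigidStabilizers.
Variables (G : groupType) (T : rooted_tree) (a : tree_action G T).

Definition boundary_act (g : G) (x : nat -> T) : nat -> T := a g \o x.

Definition rist (v : T) : set G :=
  [set g | forall x, (@boundary T `\` boundary_below v) x ->
                     boundary_act g x = x].

Definition rist_level (n : nat) : set G :=
  generated (\bigcup_(v in [set v : T | level v = n]) rist v).

Definition branch_action : Prop :=
  (forall u v : T, level u = level v -> exists g, a g u = v) /\
  (forall n, (1 <= n)%N -> finite_index (rist_level n) setT).

End RigidStabilizers.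

Definition branch_group (G : groupType) : Prop :=
  exists (T : rooted_tree) (a : tree_action G T),
    [/\ locally_finite T, faithful_action a & branch_action a].

(* Main.v *)
Require Import Defs.
From mathcomp Require Import all_boot.
From mathcomp Require fingroup perm action.
From mathcomp Require Import boolp classical_sets functions cardinality.

(** Let [G] act on a tree [T] as a finitely generated branch group and let [H] be
    a commensurated subgroup.  If [H] is finite, it is commensurate to the trivial
    group, so let [H] be infinite.  Write [rist' v] and [rist'' v] for the first
    and second derived subgroups of the rigid stabilizer of [v], and call a
    subgroup ample if it contains some [rist'' v].

    _An ample commensurated subgroup is commensurate to a normal one_
    ([commensurate_to_normal_of_rist'']).  By commensuration [H] contains, up to
    finite index, the product of all [rist'' v] on one level.  This is a nontrivial
    normal subgroup, so by Grigorchuk's double commutator trick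
    ([derived_sub_of_moved]) it contains all [rist' t] of a deeper level, and the
    quotient of [G] by the latter is virtually abelian.  There a commensurated
    subgroup has finitely many conjugates, up to finite index.

    _An infinite commensurated subgroup is ample_
    ([infinite_commensurated_ample]).  [H] has infinite intersection with every
    rigid stabilizer ([infinite_commensurated_meets_rist]), because otherwise a
    finite index subgroup of [H] would centralize all rigid stabilizers of some
    level.  Suppose that [H] is not ample.  The relation [uniform_ext] is modelled
    on the passage from [H] to the trace on [G] of the product of a closed normal
    subgroup [N] of the Schlichting completion with the closure of [H].  By Zorn's
    lemma one may assume that [H] has no proper uniform extension that is not ample
    ([maximal_not_ample]).  Two such extensions are used, both obtained as
    limits along the levels of the tree.

    The first, [level_closure], is the closure of [H] in the topology defined by
    the levels.  If it were [H], then the elements of [H] that fix a deep level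
    would fix all neighbours of the base point in the coset graph of [G] modulo
    [H], and so would form a normal subgroup of [G], making [H] ample.  Hence
    [level_closure] is ample, and since it has the same orbits as [H] on each
    level, these orbits are large ([large_orbits]).

    The second, [local_closure], comes from the subgroups [local_part e n]
    generated by the intersections of the conjugate [e H e^-1] with the rigid
    stabilizers of level [n].  For the same reason it is ample.  On a finite set of
    points of [G] modulo [H], the group [local_part e n] acts through a finite group
    whose order does not depend on [n], so its elements act like elements supported
    on boundedly many subtrees ([small_support]).  As orbits are large, these
    supports can be moved away from any other bounded set of vertices
    ([disjoint_translate]).  Elements with disjoint supports commute, so
    in the limit the local parts for all [e] generate an abelian group
    ([local_prod_commute]).

    Now [local_closure] contains a finitely generated group [F] that contains some
    [rist' t] ([fin_gen_between]).  A normal finite index subgroup [W] of [H] fixes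
    the images of the base point under the generators of [F].  Since [F] moves the
    base point like elements of an abelian group normalized by [W], the group [W]
    fixes the whole [F]-orbit of the base point ([ample_of_ample_closures]).
    The pointwise stabilizer of this orbit is
    contained in [H], meets [rist a t] nontrivially and is normalized by [rist' t];
    by Grigorchuk's trick it contains some [rist''].  So [H] is ample, which is
    a contradiction. *)

Set Implicit Arguments.
Unset Strict Implicit.
Unset Printing Implicit Defensive.

Local Open Scope classical_set_scope.
Local Open Scope group_scope.

(** * Subgroups, cosets and virtual inclusion *)

Ltac gsimp :=
  do ?rewrite (conjgE, commgEl, invgM, invgK, mulgA, mulgK, mulgVK, mulgV,
               mulVg, mul1g, mulg1, invg1).

Section VirtualInclusion.
Variable G : groupType.
Implicit Types (H K L : set G) (g x y z : G).

Lemma subgroup1 H : subgroup H -> H 1. Proof. by case. Qed.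

Lemma subgroupM H x y : subgroup H -> H x -> H y -> H (x * y).
Proof. by case=> _ + _; apply. Qed.

Lemma subgroupV H x : subgroup H -> H x -> H x^-1.
Proof. by case=> _ _; apply. Qed.

Lemma subgroupJ H x y : subgroup H -> H x -> H y -> H (x ^ y).
Proof.
move=> sH Hx Hy; rewrite conjgE.
by apply: (subgroupM sH (subgroupV sH Hy)); apply: subgroupM.
Qed.

Lemma subgroupR H x y : subgroup H -> H x -> H y -> H [~ x, y].
Proof.
move=> sH Hx Hy; rewrite commgEl.
by apply: (subgroupM sH (subgroupV sH Hx)); apply: subgroupJ.
Qed.

Lemma subgroup_setT : subgroup [set: G].
Proof. by split. Qed.

Lemma subgroup_set1 : subgroup [set (1 : G)].
Proof.
by split=> // [x y -> ->|x ->]; rewrite ?mulg1 ?invg1.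
Qed.

Lemma subgroup_setI H K : subgroup H -> subgroup K -> subgroup (H `&` K).
Proof.
move=> sH sK; split; first by split; apply: subgroup1.
  by move=> x y [Hx Kx] [Hy Ky]; split; apply: subgroupM.
by move=> x [Hx Kx]; split; apply: subgroupV.
Qed.

Lemma subgroup_bigcap (I : Type) (D : set I) (F : I -> set G) :
  (forall i, D i -> subgroup (F i)) -> subgroup (\bigcap_(i in D) F i).
Proof.
move=> sF; split=> [i Di|x y Fx Fy i Di|x Fx i Di].
- exact: subgroup1 (sF i Di).
- by apply: (subgroupM (sF i Di)); [apply: Fx|apply: Fy].
- by apply: (subgroupV (sF i Di)); apply: Fx.
Qed.

Lemma subgroup_generated (A : set G) : subgroup (generated A).
Proof.
by rewrite /generated /smallest; apply: subgroup_bigcap => H [].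
Qed.

Lemma sub_generated (A : set G) : A `<=` generated A.
Proof. exact: sub_gen_smallest. Qed.

Lemma generated_sub (A : set G) H : subgroup H -> A `<=` H -> generated A `<=` H.
Proof. exact: smallest_sub. Qed.

Lemma generatedS (A B : set G) : A `<=` B -> generated A `<=` generated B.
Proof.
move=> AB; apply: generated_sub (subgroup_generated B) _ => x /AB.
exact: sub_generated.
Qed.

(** The conjugate [g H g^-1], seen as the stabilizer of the point [g H] of the
    coset space. *)
Definition pt_stab H g : set G := [set x | H (x ^ g)].

(** The points [x H] and [y H] of the coset space coincide. *)
Definition same_pt H x y : Prop := H (x^-1 * y).

Lemma subgroup_pt_stab H g : subgroup H -> subgroup (pt_stab H g).
Proof.
move=> sH; split; rewrite /pt_stab /=.
- by rewrite conj1g; apply: subgroup1.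
- by move=> x y Hx Hy; rewrite conjMg; apply: subgroupM.
- by move=> x Hx; rewrite conjVg; apply: subgroupV.
Qed.

Lemma pt_stab1 H : pt_stab H 1 = H.
Proof. by apply/seteqP; split=> x; rewrite /pt_stab /= conjg1. Qed.

Lemma pt_stabM H x y : pt_stab (pt_stab H x) y = pt_stab H (y * x).
Proof. by apply/seteqP; split=> z; rewrite /pt_stab /= conjgM. Qed.

Lemma pt_stab_id H g : subgroup H -> H g -> pt_stab H g = H.
Proof.
move=> sH Hg; apply/seteqP; split=> x; rewrite /pt_stab /=; last first.
  by move=> Hx; apply: subgroupJ.
move=> Hxg; rewrite -(conjgK g x); apply: subgroupJ => //.
exact: subgroupV.
Qed.

Lemma pt_stabS H K g : H `<=` K -> pt_stab H g `<=` pt_stab K g.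
Proof. by move=> HK x; apply: HK. Qed.

Lemma conjugate_pt_stab H g : conjugate H g = pt_stab H g^-1.
Proof.
apply/seteqP; split=> x; rewrite /conjugate /pt_stab /=.
  by case=> y Hy <-; rewrite conjgK.
by move=> Hx; exists (x ^ g^-1) => //; rewrite conjgKV.
Qed.

Lemma pt_stabE H y w : pt_stab H y w <-> same_pt H y (w * y).
Proof. by rewrite /pt_stab /same_pt /= conjgE. Qed.

Lemma same_pt_refl H x : subgroup H -> same_pt H x x.
Proof. by move=> sH; rewrite /same_pt mulVg; apply: subgroup1. Qed.

Lemma same_pt_sym H x y : subgroup H -> same_pt H x y -> same_pt H y x.
Proof.
by move=> sH /(subgroupV sH); rewrite /same_pt invgM invgK.
Qed.

Lemma same_pt_trans H y x z :
  subgroup H -> same_pt H x y -> same_pt H y z -> same_pt H x z.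
Proof.
move=> sH Hxy Hyz; have := subgroupM sH Hxy Hyz.
by rewrite /same_pt; gsimp.
Qed.

Lemma same_ptM H g x y : same_pt H (g * x) (g * y) <-> same_pt H x y.
Proof. by rewrite /same_pt invgM -mulgA mulKg. Qed.

Lemma pt_stab_same H x y :
  subgroup H -> same_pt H x y -> pt_stab H x = pt_stab H y.
Proof.
move=> sH xy; apply/seteqP; split=> z; rewrite /pt_stab /=.
  by rewrite -(mulVKg x y) [z ^ (x * _)]conjgM => Hz; apply: subgroupJ.
rewrite -{1}(mulVKg x y) conjgM => Hz; rewrite -(conjgK (x^-1 * y) (z ^ x)).
by apply: subgroupJ => //; apply: subgroupV.
Qed.

(** For subgroups this is finiteness of the index of [H `&` K] in [K]; covers by
    left cosets have the advantage that they compose. *)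
Definition virt_sub K H : Prop :=
  exists s : seq G, forall k, K k -> exists2 c, c \in s & H (c^-1 * k).

Lemma sub_virt K H : K `<=` H -> virt_sub K H.
Proof.
move=> KH; exists [:: 1] => k Kk; exists 1; first by rewrite inE.
by rewrite invg1 mul1g; apply: KH.
Qed.

Lemma virt_trans H K L : virt_sub K H -> virt_sub H L -> virt_sub K L.
Proof.
move=> [s sP] [t tP]; exists [seq c * d | c <- s, d <- t] => k Kk.
have [c cs Hc] := sP k Kk; have [d dt Ld] := tP _ Hc.
exists (c * d); first by apply/allpairsP; exists (c, d).
by rewrite invgM -mulgA.
Qed.

Lemma virt_subr H K L : virt_sub K H -> H `<=` L -> virt_sub K L.
Proof. by move=> KH /sub_virt; apply: virt_trans. Qed.

Lemma virt_subl H K L : K `<=` H -> virt_sub H L -> virt_sub K L.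
Proof. by move=> /sub_virt; apply: virt_trans. Qed.

Lemma virt_subP K H : subgroup H -> virt_sub K H ->
  exists s : seq G, (forall c, c \in s -> K c) /\
    forall k, K k -> exists2 c, c \in s & H (c^-1 * k).
Proof.
move=> sH [s sP]; pose r c := xget 1 [set k | K k /\ H (c^-1 * k)].
exists [seq r c | c <- s & `[< exists k, K k /\ H (c^-1 * k) >]]; split.
  move=> x /mapP[c]; rewrite mem_filter => /andP[/asboolP ex _] ->.
  by have [] : K (r c) /\ H (c^-1 * r c) by exact: xgetPex ex.
move=> k Kk; have [c cs Hc] := sP k Kk.
have ex : exists k, K k /\ H (c^-1 * k) by exists k.
exists (r c).
  by apply/mapP; exists c => //; rewrite mem_filter cs andbT; apply/asboolP.
have [_ Hr] := xgetPex 1 ex.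
by have := same_pt_trans sH (same_pt_sym sH Hr : H ((r c)^-1 * c)) Hc.
Qed.

Lemma virt_setI K H L : subgroup H -> subgroup L ->
  virt_sub K H -> virt_sub K L -> virt_sub K (H `&` L).
Proof.
move=> sH sL [s sP] [t tP].
pose r c d := xget 1 [set k | K k /\ H (c^-1 * k) /\ L (d^-1 * k)].
exists [seq r c d | c <- s, d <- t] => k Kk.
have [c cs Hc] := sP k Kk; have [d dt Ld] := tP k Kk.
exists (r c d); first by apply/allpairsP; exists (c, d).
have ex : exists k, K k /\ H (c^-1 * k) /\ L (d^-1 * k) by exists k.
have [_ [Hr Lr]] := xgetPex 1 ex.
split; first exact: same_pt_trans sH (same_pt_sym sH Hr) Hc.
exact: same_pt_trans sL (same_pt_sym sL Lr) Ld.
Qed.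

Lemma virt_bigcap (I : eqType) (s : seq I) (F : I -> set G) K :
  (forall i, i \in s -> subgroup (F i)) ->
  (forall i, i \in s -> virt_sub K (F i)) ->
  virt_sub K (\bigcap_(i in [set` s]) F i).
Proof.
elim: s => [|i s IH] sF vF; first by apply: sub_virt => x _ j.
have vs : virt_sub K (F i `&` \bigcap_(j in [set` s]) F j).
  apply: virt_setI.
  - by apply: sF; rewrite inE eqxx.
  - by apply: subgroup_bigcap => j js; apply: sF; rewrite inE orbC (js : j \in s).
  - by apply: vF; rewrite inE eqxx.
  - by apply: IH => j js; [apply: sF|apply: vF]; rewrite inE js orbT.
apply: virt_subr vs _ => x [Fix Fsx] j /=.
by rewrite inE => /orP[/eqP->|js] //; apply: Fsx.
Qed.

Lemma virt_pt_stab K H g :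
  virt_sub K H -> virt_sub (pt_stab K g) (pt_stab H g).
Proof.
move=> [s sP]; exists [seq c ^ g^-1 | c <- s] => k Kk.
have [c cs Hc] := sP _ Kk; exists (c ^ g^-1); first exact: map_f.
by rewrite /pt_stab /= conjMg conjVg conjgKV.
Qed.

Lemma finite_indexP H K : subgroup H -> subgroup K ->
  finite_index (H `&` K) K <-> virt_sub K H.
Proof.
move=> sH sK; have sHK := subgroup_setI sH sK; split=> [fi|].
  pose r (A : set G) : G := xget 1 [set x | A = left_coset (H `&` K) x].
  have /finite_seqP[s sE] := finite_image r fi.
  exists s => k Kk; pose A := left_coset (H `&` K) k.
  have rE : A = left_coset (H `&` K) (r A).
    by apply: (@xgetPex _ 1 [set x | A = left_coset (H `&` K) x]); exists k.
  exists (r A).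
    have : [set` s] (r A) by rewrite -sE; exists A => //; exists k.
    by [].
  have [h [Hh _] <-] : left_coset (H `&` K) (r A) k.
    by rewrite -rE; exists 1; [apply: subgroup1|rewrite mulg1].
  by rewrite mulKg.
move=> /(virt_subP sH)[s [sK' sP]].
apply: sub_finite_set (finite_image (left_coset (H `&` K)) (finite_seq s)).
move=> _ [k Kk <-]; have [c cs Hc] := sP k Kk; exists c => //.
have HKc : (H `&` K) (c^-1 * k).
  by split=> //; apply: subgroupM => //; apply: subgroupV => //; apply: sK'.
apply/seteqP; split=> _ [h HKh <-].
  exists ((c^-1 * k)^-1 * h); last by gsimp.
  by apply: subgroupM => //; apply: subgroupV.
by exists (c^-1 * k * h); [apply: subgroupM|gsimp].
Qed.

Lemma commensurateP H K : subgroup H -> subgroup K ->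
  commensurate H K <-> virt_sub H K /\ virt_sub K H.
Proof.
move=> sH sK; rewrite /commensurate (finite_indexP sH sK).
by rewrite [H `&` K]setIC (finite_indexP sK sH); split=> -[].
Qed.

Lemma commensuratedP H : subgroup H ->
  commensurated H <-> forall g, virt_sub H (pt_stab H g).
Proof.
move=> sH; have sHg g := subgroup_pt_stab g sH; split=> [cH g|vH g h].
  have := cH 1 g^-1; rewrite !conjugate_pt_stab invg1 invgK pt_stab1.
  by case/(commensurateP sH (sHg g)).
rewrite !conjugate_pt_stab; apply/commensurateP => //; split.
  have := @virt_pt_stab _ _ g^-1 (vH (g * h^-1)).
  by rewrite pt_stabM mulKg.
have := @virt_pt_stab _ _ h^-1 (vH (h * g^-1)).
by rewrite pt_stabM mulKg.
Qed.

(** Normal core: intersecting the finitely many conjugates of [H] by the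
    elements of [K] keeps finite index in [K]. *)
Lemma virt_core K H : subgroup K -> subgroup H -> virt_sub K H ->
  exists W : set G,
    [/\ subgroup W, W `<=` H, virt_sub K W & forall k, K k -> pt_stab W k = W].
Proof.
move=> sK sH vKH; have [s [sKs sP]] := virt_subP sH vKH.
pose W := \bigcap_(k in K) pt_stab H k.
have sW : subgroup W.
  by apply: subgroup_bigcap => k _; apply: subgroup_pt_stab.
exists W; split=> //.
- by move=> x /(_ 1 (subgroup1 sK)); rewrite pt_stab1.
- have : virt_sub K (\bigcap_(c in [set` s]) pt_stab H c).
    apply: virt_bigcap => c cs; first exact: subgroup_pt_stab.
    by have := virt_pt_stab c vKH; rewrite pt_stab_id //; apply: sKs.
  move/virt_subr; apply => x Wx k Kk.
  have [c cs Hc] := sP k Kk.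
  have <- : pt_stab H (c * (c^-1 * k)) = pt_stab H k by rewrite mulVKg.
  by rewrite -pt_stabM [X in pt_stab X _]pt_stab_id //; apply: Wx.
- move=> k Kk; apply/seteqP; split=> x Wx l Kl.
    have := Wx (k^-1 * l) (subgroupM sK (subgroupV sK Kk) Kl).
    by rewrite /pt_stab /= -conjgM mulVKg.
  have := Wx (k * l) (subgroupM sK Kk Kl).
  by rewrite /pt_stab /= conjgM.
Qed.

End VirtualInclusion.

(** * Generation and commutators *)

Section Generation.
Variable G : groupType.
Implicit Types (A B H K L : set G) (g x y z : G).

Lemma pt_stab_generated A B g :
  (forall x, A x -> B (x ^ g)) ->
  forall x, generated A x -> generated B (x ^ g).
Proof.
move=> AB; apply: (generated_sub (H := pt_stab (generated B) g)).
  exact/subgroup_pt_stab/subgroup_generated.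
by move=> x /AB; apply: sub_generated.
Qed.

Definition derived K : set G :=
  generated [set z | exists x y, [/\ K x, K y & z = [~ x, y]]].

Lemma subgroup_derived K : subgroup (derived K).
Proof. exact: subgroup_generated. Qed.

Lemma mem_derived K x y : K x -> K y -> derived K [~ x, y].
Proof. by move=> Kx Ky; apply: sub_generated; exists x, y. Qed.

Lemma derived_min K L :
  subgroup L -> (forall x y, K x -> K y -> L [~ x, y]) -> derived K `<=` L.
Proof.
by move=> sL KL; apply: generated_sub => // _ [x [y [Kx Ky ->]]]; apply: KL.
Qed.

Lemma derived_sub K : subgroup K -> derived K `<=` K.
Proof. by move=> sK; apply: derived_min => // x y; apply: subgroupR. Qed.

Lemma derivedS K L : K `<=` L -> derived K `<=` derived L.
Proof. by move=> KL; apply: generatedS => _ [x [y [/KL Lx /KL Ly ->]]]; exists x, y. Qed.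

Lemma derivedJ K L g :
  (forall x, K x -> L (x ^ g)) -> forall x, derived K x -> derived L (x ^ g).
Proof.
move=> KL; apply: pt_stab_generated => _ [x [y [/KL Lx /KL Ly ->]]].
by rewrite conjRg; exists (x ^ g), (y ^ g).
Qed.

(** Commutativity modulo a subgroup normalized by [generated A] can be tested
    on [A]. *)
Lemma commutators_of_generators A K : subgroup K ->
  (forall r x, generated A r -> K x -> K (x ^ r)) ->
  (forall a b, A a -> A b -> K [~ a, b]) ->
  forall r s, generated A r -> generated A s -> K [~ r, s].
Proof.
move=> sK nK KA; have sA := subgroup_generated A.
have KAr a r : A a -> generated A r -> K [~ a, r].
  move=> Aa; move: r.
  suff: generated A `<=` [set r | generated A r /\ K [~ a, r]].
    by move=> + r Ar => /(_ r Ar)[].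
  apply: generated_sub => [|b Ab]; last first.
    by split; [apply: sub_generated|apply: KA].
  split=> [|x y [Ax Kx] [Ay Ky]|x [Ax Kx]]; split.
  - exact: subgroup1 sA.
  - by gsimp; apply: subgroup1.
  - exact: (subgroupM sA).
  - have -> : [~ a, x * y] = [~ a, y] * [~ a, x] ^ y by gsimp.
    by apply: subgroupM => //; apply: nK.
  - exact: (subgroupV sA).
  - have -> : [~ a, x^-1] = ([~ a, x] ^ x^-1)^-1 by gsimp.
    by apply: (subgroupV sK); apply: nK => //; apply: (subgroupV sA).
move=> r s; move: r.
suff: generated A `<=` [set r | generated A r /\
         forall s, generated A s -> K [~ r, s]].
  by move=> + r Ar As => /(_ r Ar)[_]; apply.
apply: generated_sub => [|b Ab]; last first.
  by split; [apply: sub_generated|move=> t; apply: KAr].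
split=> [|x y [Ax Kx] [Ay Ky]|x [Ax Kx]]; split.
- exact: subgroup1 sA.
- by move=> t _; gsimp; apply: subgroup1.
- exact: (subgroupM sA).
- move=> t At; have -> : [~ x * y, t] = [~ x, t] ^ y * [~ y, t] by gsimp.
  by apply: (subgroupM sK); [apply: nK => //; apply: Kx|apply: Ky].
- exact: (subgroupV sA).
- move=> t At; have -> : [~ x^-1, t] = ([~ x, t] ^ x^-1)^-1 by gsimp.
  by apply: (subgroupV sK); apply: nK; [apply: (subgroupV sA)|apply: Kx].
Qed.

Lemma generated_finite_support A x : generated A x ->
  exists s : seq G, [set` s] `<=` A /\ generated [set` s] x.
Proof.
move: x; apply: (generated_sub (H := [set x | exists s : seq G,
    [set` s] `<=` A /\ generated [set` s] x])).
  split=> [|x y [s [sA sx]] [t [tA ty]]|x [s [sA sx]]].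
  - by exists [::]; split=> [y|] //; apply: subgroup1 (subgroup_generated _).
  - exists (s ++ t); split.
      by move=> z /=; rewrite mem_cat => /orP[/sA|/tA].
    apply: (subgroupM (subgroup_generated _)).
      by apply: generatedS sx => z /=; rewrite mem_cat => ->.
    by apply: generatedS ty => z /=; rewrite mem_cat orbC => ->.
  - by exists s; split=> //; apply: subgroupV (subgroup_generated _) sx.
move=> x Ax; exists [:: x]; split; first by move=> y /=; rewrite inE => /eqP->.
by apply: sub_generated; rewrite /= inE.
Qed.

Definition fin_gen H : Prop := exists s : seq G, H = generated [set` s].

Lemma fin_gen_finite_support A : fin_gen (generated A) ->
  exists s : seq G, [set` s] `<=` A /\ generated A `<=` generated [set` s].
Proof.
case=> s sE.
suff [t [tA st]] : exists t : seq G, [set` t] `<=` A /\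
    [set` s] `<=` generated [set` t].
  exists t; split=> //; rewrite sE; apply: generated_sub => //.
  exact: subgroup_generated.
have : [set` s] `<=` generated A by rewrite sE; apply: sub_generated.
elim: s {sE} => [|x s IH] sA; first by exists [::]; split.
have /generated_finite_support[t1 [t1A t1x]] : generated A x.
  by apply: sA; rewrite /= inE eqxx.
have [t [tA st]] : exists t : seq G, [set` t] `<=` A /\
    [set` s] `<=` generated [set` t].
  by apply: IH => y ys; apply: sA; rewrite /= inE (ys : y \in s) orbT.
exists (t1 ++ t); split; first by move=> z /=; rewrite mem_cat => /orP[/t1A|/tA].
move=> y /=; rewrite inE => /orP[/eqP->|/st ty].
  by apply: generatedS t1x => z /=; rewrite mem_cat => ->.
by apply: generatedS ty => z /=; rewrite mem_cat orbC => ->.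
Qed.

(** Schreier's lemma.  Adding to the Schreier generators the coset
    representatives that lie in [H] makes it unnecessary to arrange that the only
    such representative is [1]. *)
Lemma fin_gen_finite_index H : fin_gen [set: G] -> subgroup H ->
  virt_sub [set: G] H -> fin_gen H.
Proof.
case=> S SE sH /(virt_subP sH)[t [_ tP]].
pose c := 1 :: t; pose S' := S ++ [seq x^-1 | x <- S].
pose B0 := [seq (p.1)^-1 * p.2 | p <- allpairs pair c [seq s * d | s <- S', d <- c]].
pose B := [seq x <- B0 ++ c | `[< H x >]].
have sB := subgroup_generated [set` B].
have BH : generated [set` B] `<=` H.
  by apply: generated_sub => // x /=; rewrite mem_filter => /andP[/asboolP].
exists B; apply/seteqP; split=> // h Hh.
(* [X], a union of cosets of the subgroup generated by [B], is stable under [S'] *)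
pose X : set G := [set g | exists2 d, d \in c & generated [set` B] (d^-1 * g)].
have stepX s g : s \in S' -> X g -> X (s * g).
  move=> sS [d dc Bdg].
  have [e et He] := tP (s * d) I.
  have ec : e \in c by rewrite inE et orbT.
  exists e => //.
  have -> : e^-1 * (s * g) = (e^-1 * (s * d)) * (d^-1 * g) by gsimp.
  apply: (subgroupM sB) => //; apply: sub_generated; rewrite /= mem_filter.
  apply/andP; split; first exact/asboolP.
  rewrite mem_cat; apply/orP; left; apply/mapP; exists (e, s * d) => //.
  by apply/allpairsP; exists (e, s * d); split=> //; apply: allpairs_f.
have XT : [set: G] `<=` [set g | (forall x, X x -> X (g * x)) /\
                                 (forall x, X x -> X (g^-1 * x))].
  rewrite SE; apply: generated_sub => [|s /= sS].
    split=> [|x y [x1 x2] [y1 y2]|x [x1 x2]]; split=> //.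
    - by move=> x; rewrite mul1g.
    - by move=> x; rewrite invg1 mul1g.
    - by move=> z Xz; rewrite -mulgA; apply/x1/y1.
    - by move=> z Xz; rewrite invgM -mulgA; apply/y2/x2.
    - by rewrite invgK.
  by split=> x; apply: stepX; rewrite mem_cat ?sS // map_f ?orbT.
have X1 : X 1.
  by exists 1; [rewrite inE eqxx|gsimp; apply: subgroup1 sB].
have [/(_ 1 X1) + _] := XT h I; rewrite mulg1 => -[d dc Bdh].
have Hd : H d.
  have -> : d = h * (d^-1 * h)^-1 by gsimp.
  by apply: (subgroupM sH) => //; apply: (subgroupV sH); apply: BH.
have Bd : generated [set` B] d.
  apply: sub_generated; rewrite /= mem_filter; apply/andP; split; first exact/asboolP.
  by rewrite mem_cat dc orbT.
by rewrite -(mulVKg d h); apply: (subgroupM sB).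
Qed.

End Generation.

(** * Extensions of commensurated subgroups *)

Lemma eventually_all (A : eqType) (s : seq A) (Q : A -> nat -> Prop) :
  (forall a m n, (m <= n)%N -> Q a m -> Q a n) ->
  (forall a, a \in s -> exists n, Q a n) ->
  exists n, forall a, a \in s -> Q a n.
Proof.
move=> Qinc; elim: s => [|a s IH] Qs; first by exists 0%N.
have [|n nP] := IH; first by move=> b bs; apply: Qs; rewrite inE bs orbT.
have [|m mP] := Qs a; first by rewrite inE eqxx.
exists (maxn m n) => b; rewrite inE => /orP[/eqP->|/nP Qb].
  by apply: Qinc mP; apply: leq_maxl.
by apply: Qinc Qb; apply: leq_maxr.
Qed.

Lemma stable_pigeonhole (A : eqType) (s : seq A) (Q : A -> nat -> Prop) :
  (forall a m n, (m <= n)%N -> Q a n -> Q a m) ->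
  (forall n, exists2 a, a \in s & Q a n) ->
  exists2 a, a \in s & forall n, Q a n.
Proof.
move=> Qdec Qs; apply: contrapT => nQ.
have [a m n mn nQm Qn||n nP] := @eventually_all A s (fun a n => ~ Q a n).
- by apply: nQm; apply: Qdec mn Qn.
- move=> a as_; apply: contrapT => nbad; apply: nQ; exists a => // n.
  by apply: contrapT => nQan; apply: nbad; exists n.
by have [a /nP] := Qs n.
Qed.

Section Extensions.
Variable G : groupType.
Implicit Types (H K L : set G) (g x y z : G).

(** For subgroups, [K] is the product of [H] with the intersection of [K] and
    [g K g^-1], for every [g].  This holds if [K] is the trace on [G] of the product
    of a closed normal subgroup of the Schlichting completion with the closure of
    [H].  It makes [K] commensurated when [H] is, and unlike commensuration itself
    it survives unions of chains. *)
Definition uniform_ext H K : Prop :=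
  H `<=` K /\ forall g x, K x -> exists2 h, H h & pt_stab K g (h^-1 * x).

Lemma uniform_ext_refl H : subgroup H -> uniform_ext H H.
Proof.
move=> sH; split=> // g x Hx; exists x => //.
by rewrite mulVg; apply: subgroup1; apply: subgroup_pt_stab.
Qed.

Lemma uniform_ext_trans H K L : subgroup L ->
  uniform_ext H K -> uniform_ext K L -> uniform_ext H L.
Proof.
move=> sL [HK uHK] [KL uKL]; split; first by move=> x /HK /KL.
move=> g x Lx; have [k Kk Lk] := uKL g x Lx; have [h Hh Kh] := uHK g k Kk.
exists h => //; have -> : h^-1 * x = (h^-1 * k) * (k^-1 * x) by gsimp.
apply: (subgroupM (subgroup_pt_stab g sL)) => //.
exact: pt_stabS KL _ Kh.
Qed.

Lemma uniform_ext_commensurated H K :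
  subgroup H -> subgroup K -> uniform_ext H K ->
  commensurated H -> commensurated K.
Proof.
move=> sH sK [HK uHK] /(commensuratedP sH) cH; apply/(commensuratedP sK) => g.
have [s sP] := cH g; exists s => x /(uHK g)[h Hh Kh].
have [c cs Hc] := sP h Hh; exists c => //.
have -> : c^-1 * x = (c^-1 * h) * (h^-1 * x) by gsimp.
apply: (subgroupM (subgroup_pt_stab g sK)) => //.
exact: pt_stabS HK _ Hc.
Qed.

(** A presentation, by sets of approximations of order [n], of a normal subgroup
    of the Schlichting completion: [N i n] holds the approximations of order [n]
    of the elements with label [i]. *)
Definition limit_system (I : Type) (N : I -> nat -> set G) : Prop :=
  [/\ forall i m n, (m <= n)%N -> N i n `<=` N i m,
      exists i, forall n, N i n 1,
      forall i j, exists k, forall n x y, N i n x -> N j n y -> N k n (x * y),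
      forall i, exists k, forall n x, N i n x -> N k n x^-1 &
      forall i g, exists k, forall n x, N i n x -> N k n (x ^ g)].

(** The elements that move the base point of the coset space like a limit of
    the system. *)
Definition limit_ext (I : Type) (N : I -> nat -> set G) H : set G :=
  [set x | exists i, forall n, exists2 p, N i n p & same_pt H p x].

Section Limit.
Variables (I : Type) (N : I -> nat -> set G) (H : set G).
Hypotheses (lN : limit_system N) (sH : subgroup H).

Lemma subgroup_limit_ext : subgroup (limit_ext N H).
Proof.
have [_ [i0 N1] NM NV NJ] := lN; split.
- by exists i0 => n; exists 1; [apply: N1|apply: same_pt_refl].
- move=> x y [i iP] [j jP]; have [j' j'P] := NJ j x^-1.
  have [k kP] := NM j' i; exists k => n.
  have [p Np Hp] := iP n; have [q Nq Hq] := jP n.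
  exists (q ^ x^-1 * p); first by apply: kP => //; apply: j'P.
  by have := subgroupM sH Hp Hq; rewrite /same_pt; gsimp.
- move=> x [i iP]; have [j jP] := NV i; have [k kP] := NJ j x.
  exists k => n; have [p Np Hp] := iP n.
  exists (p^-1 ^ x); first exact/kP/jP.
  by have := subgroupV sH Hp; rewrite /same_pt; gsimp.
Qed.

Lemma sub_limit_ext : H `<=` limit_ext N H.
Proof.
have [_ [i0 N1] _ _ _] := lN => x Hx; exists i0 => n; exists 1 => //.
by rewrite /same_pt invg1 mul1g.
Qed.

(** An element of the extension differs from its approximations by elements of
    [H].  Modulo [pt_stab H g] the latter take finitely many values, so by the
    pigeonhole principle one value serves for all orders. *)
Lemma uniform_limit_ext : commensurated H -> uniform_ext H (limit_ext N H).
Proof.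
move=> /(commensuratedP sH) cH; split=> [|g x Lx]; first exact: sub_limit_ext.
have sL := subgroup_limit_ext; have [Ndec _ _ _ NJ] := lN.
have [i iP] := subgroupV sL Lx.
have [s [sH' sP]] := virt_subP (subgroup_pt_stab g sH) (cH g).
pose Q c n := exists p, [/\ N i n p, H (p^-1 * x^-1) &
                            pt_stab H g (c^-1 * (x * p))].
have [c cs cQ] : exists2 c, c \in s & forall n, Q c n.
  apply: stable_pigeonhole => [a m n mn [p [Np Hp Hg]]|n].
    by exists p; split=> //; apply: Ndec mn _ Np.
  have [p Np Hp] := iP n.
  have [|c cs Hc] := sP (x * p); last by exists c => //; exists p.
  by have := subgroupV sH Hp; rewrite invgM !invgK.
exists c; first exact: sH'.
have [k kP] := NJ i g.
suff : limit_ext N H ((c^-1 * x) ^ g)^-1 by move/(subgroupV sL); rewrite invgK.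
exists k => n; have [p [Np _ Hg]] := cQ n.
exists (p ^ g); first exact: kP.
by have := subgroupV (subgroup_pt_stab g sH) Hg; rewrite /pt_stab /same_pt /=; gsimp.
Qed.

(** If elements of [H] that move the point [g H] were found among the
    approximations of all orders, then by the pigeonhole principle they could be
    taken to move it to one and the same point [c g H], and [c ^ g] would be a new
    element of the extension. *)
Lemma limit_ext_stable : commensurated H -> limit_ext N H `<=` H ->
  forall i g, exists n, N i n `&` H `<=` pt_stab H g.
Proof.
move=> /(commensuratedP sH) cH LH i g; apply: contrapT => nP.
have [Ndec _ _ _ NJ] := lN; have sHg := subgroup_pt_stab g sH.
have [s sP] := cH g.
pose Q c n := exists p, [/\ N i n p, ~ pt_stab H g p & pt_stab H g (c^-1 * p)].
have [c cs cQ] : exists2 c, c \in s & forall n, Q c n.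
  apply: stable_pigeonhole => [a m n mn [p [Np Hp Hg]]|n].
    by exists p; split=> //; apply: Ndec mn _ Np.
  have [p [[Np Hp] nHp]] : exists p, (N i n `&` H) p /\ ~ pt_stab H g p.
    apply: contrapT => nex; apply: nP; exists n => p Np.
    by apply: contrapT => nHp; apply: nex; exists p.
  by have [c cs Hc] := sP p Hp; exists c => //; exists p.
have [k kP] := NJ i g.
have Hc : pt_stab H g c.
  apply: LH; exists k => n; have [p [Np _ Hg]] := cQ n.
  exists (p ^ g); first exact: kP.
  by have := subgroupV sHg Hg; rewrite /pt_stab /same_pt /=; gsimp.
have [p [_ nHp Hg]] := cQ 0%N; apply: nHp.
by rewrite -(mulVKg c p); apply: (subgroupM sHg).
Qed.

End Limit.
End Extensions.

(** * Finite quotients and finite orbits *)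

Section Counting.
Variable G : groupType.

Lemma ltn_count (A : eqType) (a b : pred A) (s : seq A) x :
  subpred a b -> x \in s -> b x -> ~~ a x -> (count a s < count b s)%N.
Proof.
move=> ab xs bx nax; rewrite -[count b s]size_filter -(count_predC a).
rewrite count_filter (eq_count (a2 := a)); last first.
  by move=> y /=; case ay: (a y) => //; rewrite (ab y ay).
rewrite -[X in (X < _)%N]addn0 ltn_add2l -has_count.
by apply/hasP; exists x => //; rewrite mem_filter bx.
Qed.

Lemma size_le_cover (A B : eqType) (P : A -> pred B) (s : seq A) (t : seq B) :
  (forall x, x \in t -> exists2 c, c \in s & P c x) ->
  (size t <= \sum_(c <- s) count (P c) t)%N.
Proof.
elim: t => [//|x t IH] cov.
rewrite [X in (_ <= X)%N](_ : _ = \sum_(c <- s) P c x + \sum_(c <- s) count (P c) t)%N;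
  last by rewrite -big_split.
rewrite /= -add1n leq_add //; last by apply: IH => y yt; apply: cov; rewrite inE yt orbT.
have [|c cs Pc] := cov x; first by rewrite inE eqxx.
by rewrite (big_rem c) //= Pc.
Qed.

(** In the quotient by [W], a group with at most [size s] elements, each member of
    the family that is not yet in the subgroup generated by the previous ones makes
    this subgroup larger. *)
Lemma bounded_support (I : eqType) (D : set I) (L : I -> set G) (K W : set G)
    (s : seq G) :
  subgroup K -> subgroup W -> (forall k, K k -> pt_stab W k = W) ->
  (forall k, K k -> exists2 c, c \in s & W (c^-1 * k)) ->
  (forall i, D i -> L i `<=` K) ->
  exists J : seq I, [/\ (size J <= size s)%N, [set` J] `<=` D &
    forall p, generated (\bigcup_(i in D) L i) p ->
      exists2 q, generated (\bigcup_(i in [set` J]) L i) q & W (q^-1 * p)].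
Proof.
move=> sK sW nW sP LK.
have WJ k z : K k -> W z -> W (z ^ k).
  by move=> Kk Wz; have : pt_stab W k z by rewrite nW.
pose gen (J : seq I) := generated (\bigcup_(i in [set` J]) L i).
have sgen J : subgroup (gen J) by apply: subgroup_generated.
have genK J : [set` J] `<=` D -> gen J `<=` K.
  by move=> JD; apply: generated_sub => // x [i /JD Di]; apply: LK.
(* the order of the subgroup generated by [J] modulo [W], seen in [s] *)
pose hits J := count (fun c => `[< exists2 q, gen J q & W (c^-1 * q) >]) s.
pose good J := forall p, generated (\bigcup_(i in D) L i) p ->
  exists2 q, gen J q & W (q^-1 * p).
have step J : (size J <= hits J)%N -> [set` J] `<=` D -> good J \/
    exists J', [/\ (size J' <= hits J')%N, [set` J'] `<=` D & (hits J < hits J')%N].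
  move=> Jh JD.
  have [all_in|/existsNP[i /not_implyP[Di /existsNP[l /not_implyP[Ll nl]]]]] :=
    pselect (forall i, D i -> forall l, L i l -> exists2 q, gen J q & W (q^-1 * l)).
  - left; suff: generated (\bigcup_(i in D) L i) `<=`
                [set p | K p /\ exists2 q, gen J q & W (q^-1 * p)].
      by move=> sub p /sub[].
    apply: generated_sub => [|l [i Di Ll]]; last first.
      by split; [apply: (LK i)|apply: (all_in i)].
    split=> [|x y [Kx [p gp Wp]] [Ky [q gq Wq]]|x [Kx [p gp Wp]]].
    + split; first exact: subgroup1 sK.
      by exists 1; [apply: subgroup1 (sgen J)|rewrite mulVg; apply: subgroup1 sW].
    + split; first exact: (subgroupM sK).
      exists (p * q); first exact: (subgroupM (sgen J)).
      have -> : (p * q)^-1 * (x * y) = (q^-1 * y) * (p^-1 * x) ^ y by gsimp.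
      by apply: (subgroupM sW) => //; apply: WJ.
    + split; first exact: (subgroupV sK).
      exists p^-1; first exact: (subgroupV (sgen J)).
      have -> : p^-1^-1 * x^-1 = ((p^-1 * x)^-1) ^ x^-1 by gsimp.
      by apply: WJ; [apply: (subgroupV sK)|apply: (subgroupV sW)].
  - right; exists (i :: J).
    have JiJ : gen J `<=` gen (i :: J).
      apply: generatedS => x [j /= jJ Lj]; exists j => //=.
      by rewrite inE jJ orbT.
    have lt : (hits J < hits (i :: J))%N.
      have [c cs Wc] := sP l (LK i Di l Ll).
      apply: (ltn_count (x := c)) => //.
      + move=> d /asboolP[q Jq Wq]; apply/asboolP; exists q => //; exact: JiJ.
      + apply/asboolP; exists l => //; apply: sub_generated; exists i => //=.
        by rewrite inE eqxx.
      + apply/asboolP => -[q Jq Wq]; apply: nl; exists q => //.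
        exact: same_pt_trans sW (same_pt_sym sW Wq) Wc.
    split=> //; first exact: leq_ltn_trans lt.
    by move=> j /=; rewrite inE => /orP[/eqP->//|/JD].
have main m : forall J, (size J <= hits J)%N -> [set` J] `<=` D ->
    (size s - hits J < m)%N ->
    exists J, [/\ (size J <= size s)%N, [set` J] `<=` D & good J].
  elim: m => // m IH J Jh JD lt_m; have [gJ|[J' [J'h J'D lt]]] := step J Jh JD.
    by exists J; split=> //; apply: leq_trans Jh (count_size _ _).
  apply: (IH J') => //; have hJ' : (hits J' <= size s)%N := count_size _ _.
  have : (size s - hits J' < size s - hits J)%N.
    exact: ltn_sub2l (leq_trans lt hJ') lt.
  by move=> lt2; apply: leq_trans lt2 _; rewrite -ltnS.
exact: (main _ [::]).
Qed.
End Counting.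

Section DisjointTranslate.
Import fingroup perm action.
Variables (G : groupType) (V : choiceType) (act : G -> V -> V).
Hypothesis act1 : forall v, act 1 v = v.
Hypothesis actM : forall g h v, act (g * h) v = act g (act h v).

(** In the finite group of permutations of [s] induced by [K], those that send a
    given point [x] to a given point [y] are a proportion of at most one over the
    size of the orbit of [x].  There are [size J * size J'] pairs to be avoided. *)
Lemma disjoint_translate (K : set G) (s J J' : seq V) :
  subgroup K -> (forall k v, K k -> v \in s -> act k v \in s) ->
  {subset J <= s} -> {subset J' <= s} ->
  (forall v, v \in J -> exists t, [/\ uniq t, (size J * size J' < size t)%N &
     forall u, u \in t -> exists2 k, K k & act k v = u]) ->
  exists2 k, K k & forall v, v \in J -> act k v \notin J'.
Proof.
move=> sK Ks Js J's big; pose X := seq_sub s.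
have actK g v : act g^-1 (act g v) = v by rewrite -actM mulVg act1.
pose f k (Kk : K k) (x : X) : X := SeqSub (Ks k (ssval x) Kk (ssvalP x)).
have f_inj k (Kk : K k) : injective (f k Kk).
  move=> x y /(congr1 (@ssval _ _)) /= fxy; apply/val_inj => /=.
  by rewrite -(actK k (ssval x)) fxy actK.
pose P := finset.finset (fun p : {perm X} =>
  `[< exists2 k, K k & forall x : X, ssval (p x) = act k (ssval x) >]).
have inP (p : {perm X}) : (p \in P) <->
    exists2 k, K k & forall x : X, ssval (p x) = act k (ssval x).
  by rewrite finset.in_set; split=> /asboolP.
have gP : group_set P.
  apply/group_setP; split.
    by apply/inP; exists 1%g; [apply: subgroup1 sK|move=> x; rewrite perm1 act1].
  move=> p q /inP[k Kk pk] /inP[l Kl ql]; apply/inP; exists (l * k)%g.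
    exact: (subgroupM sK).
  by move=> x; rewrite permM ql pk actM.
pose Pg := Group gP.
apply: contrapT => nK.
have Pbad (p : {perm X}) : p \in P -> exists2 v, v \in J &
    exists2 u, u \in J' & exists (x : X), ssval x = v /\ ssval (p x) = u.
  move=> /inP[k Kk pk]; apply: contrapT => nbad; apply: nK; exists k => // v vJ.
  apply/negP => kvJ'; apply: nbad; exists v => //; exists (act k v) => //.
  by exists (SeqSub (Js v vJ)); rewrite pk.
pose JX := pmap (insub : V -> option X) J.
pose J'X := pmap (insub : V -> option X) J'.
have memJX (x : X) : (x \in JX) = (ssval x \in J).
  by rewrite mem_pmap_sub.
have memJ'X (x : X) : (x \in J'X) = (ssval x \in J').
  by rewrite mem_pmap_sub.
have szJX : (size JX <= size J)%N by rewrite size_pmap_sub; apply: count_size.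
have szJ'X : (size J'X <= size J')%N by rewrite size_pmap_sub; apply: count_size.
pose N := (size J * size J')%N.
have cardP : (#|P| <= \sum_(x <- JX) \sum_(y <- J'X) #|amove 'P P x y|)%N.
  have -> : (\sum_(x <- JX) \sum_(y <- J'X) #|amove 'P P x y| =
      \sum_(p in P) \sum_(x <- JX) \sum_(y <- J'X) (p \in amove 'P P x y))%N.
    rewrite [RHS]exchange_big; apply: eq_bigr => x _.
    rewrite [RHS]exchange_big; apply: eq_bigr => y _.
    rewrite -sum1_card big_mkcond [RHS]big_mkcond; apply: eq_bigr => p _ /=.
    by rewrite finset.in_set; case: (p \in P).
  rewrite -sum1_card; apply: leq_sum => p Pp.
  have [v vJ [u uJ' [x [xv pxu]]]] := Pbad p Pp.
  rewrite (big_rem x) ?memJX ?xv //= (big_rem (p x)) ?memJ'X ?pxu //=.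
  by rewrite finset.in_set Pp /= /aperm eqxx.
have amv x (y : X) : x \in JX -> (#|amove 'P P x y| * N.+1 <= #|P|)%N.
  rewrite memJX => xJ; have [t [ut szt tP]] := big _ xJ.
  have orb : (N.+1 <= #|orbit 'P Pg x|)%N.
    have ts u : u \in t -> u \in s.
      by move=> /tP[k Kk <-]; apply: (Ks k) => //; apply: (Js _ xJ).
    apply: leq_trans szt _; pose tX := pmap (insub : V -> option X) t.
    have <- : size tX = size t.
      by rewrite size_pmap_sub; apply/eqP; rewrite -all_count; apply/allP.
    rewrite cardE; apply: uniq_leq_size; first exact: pmap_sub_uniq.
    move=> z; rewrite mem_pmap_sub mem_enum => /tP[k Kk kz].
    apply/orbitP; exists (perm (@f_inj k Kk)).
      by apply/inP; exists k => // w; rewrite permE.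
    by apply/val_inj; rewrite /= /aperm permE /= kz.
  rewrite -(card_orbit_in_stab 'P (G := Pg) x) ?finset.subsetT // mulnC leq_mul //.
  have [->|[p]] := finset.set_0Vmem (amove 'P P x y); first by rewrite finset.cards0.
  rewrite finset.in_set => /andP[Pp /eqP <-].
  have sP : Pg \subset finset.setT by apply: finset.subsetT.
  by rewrite (amove_act 'P x sP) ?finset.subsetT // card_rcoset.
have : (#|P| * N.+1 <= N * #|P|)%N.
  apply: leq_trans (leq_mul cardP (leqnn _)) _.
  rewrite big_distrl /=; apply: leq_trans (_ : \sum_(x <- JX) size J' * #|P| <= _)%N.
    rewrite big_seq [X in (_ <= X)%N]big_seq; apply: leq_sum => x xJ.
    rewrite big_distrl /=; apply: leq_trans (_ : \sum_(y <- J'X) #|P| <= _)%N.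
      by apply: leq_sum => y _; apply: amv.
    by rewrite big_const_seq count_predT iter_addn_0 mulnC leq_mul2r szJ'X orbT.
  rewrite big_const_seq count_predT iter_addn_0 /N mulnC mulnA.
  by rewrite leq_mul2r leq_mul2r szJX !orbT.
rewrite mulnC leq_pmul2r ?ltnn //.
by apply/card_gt0P; exists 1%g; apply: (group1 Pg).
Qed.
End DisjointTranslate.

(** * Rooted trees and rigid stabilizers *)

Section TreeAction.
Variables (G : groupType) (T : rooted_tree) (a : tree_action G T).
Implicit Types (g h : G) (v w t u : T).

Definition anc (n : nat) t : T := iter (level t - n) parent t.

Definition below v t : Prop := (level v <= level t)%N /\ anc (level v) t = v.

Lemma level_iter k t : level (iter k parent t) = (level t - k)%N.
Proof.
by elim: k => [|k IH]; rewrite ?subn0 // iterS level_parent IH subnS.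
Qed.

Lemma level_root : level (Defs.root : T) = 0%N.
Proof. exact/level_eq0. Qed.

Lemma parent_root : parent (Defs.root : T) = Defs.root.
Proof. by apply/level_eq0; rewrite level_parent level_root. Qed.

Lemma act_parent g v : a g (parent v) = parent (a g v).
Proof. by case: (act_automorphism a g). Qed.

Lemma act_iter g k t : a g (iter k parent t) = iter k parent (a g t).
Proof. by elim: k => // k IH; rewrite !iterS act_parent IH. Qed.

Lemma actK g : cancel (a g) (a g^-1).
Proof. by move=> v; rewrite -actM mulVg act1. Qed.

Lemma actKV g : cancel (a g^-1) (a g).
Proof. by move=> v; rewrite -actM mulgV act1. Qed.

Lemma act_inj g : injective (a g). Proof. exact: can_inj (actK g). Qed.

Lemma act_root g : a g Defs.root = Defs.root.
Proof.
apply/level_eq0; have := congr1 level (act_parent g Defs.root).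
by rewrite parent_root level_parent; case: level => // n /eqP; rewrite eqn_leq ltnn.
Qed.

Lemma level_act g v : level (a g v) = level v.
Proof.
have le h t : (level (a h t) <= level t)%N.
  rewrite -subn_eq0 -level_iter -act_iter.
  have -> : iter (level t) parent t = Defs.root.
    by apply/level_eq0; rewrite level_iter subnn.
  by rewrite act_root level_root.
apply/eqP; rewrite eqn_leq le /=.
by rewrite -{1}(actK g v) le.
Qed.

Lemma act_anc g n t : a g (anc n t) = anc n (a g t).
Proof. by rewrite /anc act_iter level_act. Qed.

Lemma level_anc n t : (n <= level t)%N -> level (anc n t) = n.
Proof. by move=> nt; rewrite /anc level_iter subKn. Qed.

Lemma anc_anc m n t : (m <= n)%N -> (n <= level t)%N -> anc m (anc n t) = anc m t.
Proof.
move=> mn nt; rewrite /anc level_iter subKn // -iterD addnC addnBA //.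
by rewrite subnK.
Qed.

Lemma anc_level t : anc (level t) t = t.
Proof. by rewrite /anc subnn. Qed.

Lemma below_refl v : below v v.
Proof. by split=> //; apply: anc_level. Qed.

Lemma below_trans v w t : below v w -> below w t -> below v t.
Proof.
move=> [vw vwE] [wt wtE]; split; first exact: leq_trans vw wt.
by rewrite -(anc_anc vw wt) wtE.
Qed.

Lemma below_act g v t : below v t -> below (a g v) (a g t).
Proof. by move=> [vt vtE]; split; rewrite ?level_act // -act_anc vtE. Qed.

Lemma below_actE g v t : below (a g v) (a g t) <-> below v t.
Proof.
split; last exact: below_act.
by move/(below_act g^-1); rewrite !actK.
Qed.

Lemma below_anc n t : (n <= level t)%N -> below (anc n t) t.
Proof. by move=> nt; split; rewrite level_anc. Qed.

Definition level_stab (n : nat) : set G :=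
  [set g | forall v, (level v <= n)%N -> a g v = v].

Lemma subgroup_fix (D : set T) : subgroup [set g | forall v, D v -> a g v = v].
Proof.
split=> [v _|x y fx fy v Dv|x fx v Dv]; first exact: act1.
  by rewrite actM fy // fx.
by rewrite -{1}(fx v Dv) actK.
Qed.

Lemma subgroup_level_stab n : subgroup (level_stab n).
Proof. exact: subgroup_fix. Qed.

Lemma level_stabJ n g x : level_stab n x -> level_stab n (x ^ g).
Proof.
by move=> sx v vn; rewrite conjgE !actM sx ?level_act // actK.
Qed.

Lemma level_stabS m n : (m <= n)%N -> level_stab n `<=` level_stab m.
Proof. by move=> mn g sg v vm; apply: sg; apply: leq_trans mn. Qed.

Section LocallyFinite.
Hypothesis lfT : locally_finite T.

Lemma finite_level n : exists s : seq {classic T},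
  forall v : {classic T}, v \in s <-> level v = n.
Proof.
suff [s sP] : exists s : seq {classic T}, forall v : {classic T}, level v = n -> v \in s.
  exists [seq v : {classic T} <- s | level v == n] => v; rewrite mem_filter.
  by split=> [/andP[/eqP]|vn] //; rewrite sP // vn eqxx.
elim: n => [|n [s sP]].
  by exists [:: Defs.root] => v /level_eq0 ->; rewrite inE.
have [c cP] : {c : {classic T} -> seq {classic T} &
    forall v, forall w : {classic T}, parent w = v -> w \in c v}.
  apply: (choice (P := fun v (c : seq {classic T}) =>
    forall w : {classic T}, parent w = v -> w \in c)) => v.
  have /(@finite_seqP {classic T})[t tE] := lfT v.
  exists t => w wv; suff : [set` t] w by [].
  by rewrite -tE.
exists (flatten (map c s)) => v vn.
apply/flattenP; exists (c (parent v)); last exact: cP.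
by apply: (map_f c); apply: sP; rewrite level_parent vn.
Qed.

(** An element of [G] is determined, modulo the stabilizer of a vertex, by the
    image of this vertex, and levels are finite. *)
Lemma virt_level_stab n : virt_sub [set: G] (level_stab n).
Proof.
have stab1 (v : {classic T}) : virt_sub [set: G] [set g | a g v = v].
  have [s sP] := finite_level (level v).
  pose r (u : {classic T}) := xget 1 [set g | a g v = u].
  exists (map r s) => g _; exists (r (a g v)).
    by apply: (map_f r); apply/sP; rewrite level_act.
  have rE : a (r (a g v)) v = a g v.
    by apply: (@xgetPex _ 1 [set h | a h v = a g v]); exists g.
  by rewrite /= actM; apply: (can_inj (actK (r (a g v)))); rewrite actKV.
elim: n => [|n IH].
  apply: sub_virt => g _ v; rewrite leqn0 => /eqP/level_eq0 ->.
  exact: act_root.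
have [s sP] := finite_level n.+1.
have sub1 (v : {classic T}) : subgroup [set g | a g v = v].
  by have := subgroup_fix [set v]; congr subgroup; apply/seteqP; split=> g /=;
    [apply|move=> gv _ ->].
have vs : virt_sub [set: G] (\bigcap_(v in [set` s]) [set g | a g v = v]).
  by apply: virt_bigcap => v _; [apply: sub1|apply: stab1].
apply: virt_subr (virt_setI (subgroup_level_stab n) _ IH vs) _.
  by apply: subgroup_bigcap => v _; apply: sub1.
move=> g [gn gs] v; rewrite leq_eqVlt => /orP[/eqP vn|]; last by rewrite ltnS; apply: gn.
by apply: gs; apply/sP.
Qed.

End LocallyFinite.
End TreeAction.

(** * Branch actions *)

Section Branch.
Variables (G : groupType) (T : rooted_tree) (a : tree_action G T).
Hypotheses (lfT : locally_finite T) (faith : faithful_action a).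
Hypothesis branch : branch_action a.
Hypothesis infinite : ~ virt_sub [set: G] [set 1].
Implicit Types (g h x y z : G) (v w t u : T).

Lemma act_trivial g : (forall v, a g v = v) -> g = 1.
Proof. by move=> gv; apply: faith; apply/funext => v; rewrite gv act1. Qed.

Lemma act_transitive u v : level u = level v -> exists g, a g u = v.
Proof. by case: branch => + _; apply. Qed.

(** By transitivity a leaf would be on the last level of the tree, and the group,
    acting faithfully, would be finite. *)
Lemma exists_child v : exists t, parent t = v /\ level t = (level v).+1.
Proof.
apply: contrapT => leaf; apply: infinite.
apply: virt_subr (virt_level_stab a lfT (level v)) _ => g sg.
apply: act_trivial => t; apply: sg; rewrite leqNgt; apply/negP => lt.
have [g' gE] : exists g', a g' (anc (level v) t) = v.
  by apply: act_transitive; rewrite level_anc // ltnW.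
apply: leaf; exists (a g' (anc (level v).+1 t)); split; last first.
  by rewrite level_act level_anc.
by rewrite -act_parent -[parent _]/(iter 1 parent _) -[RHS]gE /anc -iterD add1n subnSK.
Qed.

Lemma exists_below v n : (level v <= n)%N -> exists t, below v t /\ level t = n.
Proof.
elim: n => [|n IH]; rewrite leq_eqVlt => /orP[/eqP vn|vn] //.
- by exists v; split=> //; apply: below_refl.
- by exists v; split=> //; apply: below_refl.
have [t [vt tn]] := IH vn; have [w [wt wn]] := exists_child t.
exists w; rewrite wn tn; split=> //; apply: below_trans vt _.
split; first by rewrite wn.
by rewrite /anc wn subSnn /= wt.
Qed.

Lemma exists_ray t : exists2 x, boundary x & x (level t) = t.
Proof.
have [c cP] := choice exists_child.
exists (fun n => if (n <= level t)%N then anc n t else iter (n - level t) c t); last first.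
  by rewrite leqnn anc_level.
have lc k : level (iter k c t) = (level t + k)%N.
  elim: k => [|k IH]; first by rewrite addn0.
  by rewrite iterS; have [_ ->] := cP (iter k c t); rewrite IH addnS.
split; first by apply/level_eq0; rewrite level_anc.
move=> n; case: (ltngtP n (level t)) => [nt|tn|->].
- rewrite level_anc //; split=> //.
  by rewrite -[parent _]/(iter 1 parent _) /anc -iterD add1n subnSK.
- rewrite lc subSn ?(ltnW tn) // iterS; have [-> _] := cP (iter (n - level t) c t).
  by rewrite addnS subnKC // ltnW.
- by rewrite subSnn /=; have [-> ->] := cP t; rewrite anc_level.
Qed.

Lemma level_ray (x : nat -> T) n : @boundary T x -> level (x n) = n.
Proof.
by case=> x0 xS; case: n => [|n]; [rewrite x0 level_root|case: (xS n)].
Qed.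

Lemma anc_ray (x : nat -> T) m n : @boundary T x -> (m <= n)%N -> anc m (x n) = x m.
Proof.
move=> bx mn; rewrite /anc level_ray // -{2}(subnKC mn).
elim: (n - m)%N => [|k IH]; first by rewrite addn0.
by rewrite iterSr addnS; case: (bx.2 (m + k)%N) => _ ->.
Qed.

(** Every vertex outside the subtree below [v] whose level is at least that of [v]
    lies on a ray that avoids [v].  So [g] in [rist a v] fixes the vertices of the
    level of [v] other than [v], hence also [v] itself and the vertices above. *)
Lemma ristP v g :
  rist a v g <-> forall t, ~ below v t -> a g t = t.
Proof.
split=> [rg|fg x [bx nbx]]; last first.
  apply/funext => n; rewrite /boundary_act /=; apply: fg => -[vn vE].
  apply: nbx; split=> //; exists (level v).
  by rewrite -[RHS]vE anc_ray // -(level_ray n bx).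
have fix_ge t : (level v <= level t)%N -> ~ below v t -> a g t = t.
  move=> vt nvt; have [x bx xt] := exists_ray t.
  have rgx : boundary_act a g x = x.
    apply: rg; split=> // -[_ [n xn]]; apply: nvt; split=> //.
    have nE : n = level v by rewrite -xn level_ray.
    by rewrite -{2}xn nE -xt anc_ray // -nE xn.
  by have := congr1 (fun f => f (level t)) rgx; rewrite /boundary_act /= xt.
have fix_v : a g v = v.
  apply: contrapT => gv; apply: (gv); apply: (@act_inj _ _ a g).
  apply: fix_ge; first by rewrite level_act.
  by move=> [_]; rewrite -(level_act a g v) anc_level.
move=> t nvt; have [vt|tv] := leqP (level v) (level t); first exact: fix_ge.
have [w [tw wv]] := exists_below (ltnW tv).
have gw : a g w = w.
  have [wv'|wv'] := pselect (below v w); last by apply: fix_ge => //; rewrite wv.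
  by case: wv' => _; rewrite -wv anc_level => ->; rewrite fix_v.
by case: tw => _ <-; rewrite act_anc gw.
Qed.

Lemma subgroup_rist v : subgroup (rist a v).
Proof.
have := subgroup_fix a [set t | ~ below v t]; congr subgroup.
by apply/seteqP; split=> g /ristP.
Qed.

Lemma ristJ v g x : rist a v x -> rist a (a g^-1 v) (x ^ g).
Proof.
move=> /ristP rx; apply/ristP => t nvt; rewrite conjgE !actM rx ?actK //.
by move=> vt; apply: nvt; rewrite -{1}(actK a g t); apply: below_act.
Qed.

Lemma pt_stab_rist v g : pt_stab (rist a v) g = rist a (a g v).
Proof.
apply/seteqP; split=> x; rewrite /pt_stab /=; last first.
  by move/(@ristJ _ g); rewrite actK.
by move/(@ristJ _ g^-1); rewrite invgK conjgK.
Qed.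

Lemma rist_level_stab v : rist a v `<=` level_stab a (level v).
Proof.
move=> g /ristP rg t tv; have [vt|] := pselect (below v t); last exact: rg.
have tE : t = v.
  have [vlt <-] := vt; rewrite -{1}(anc_level t); congr (anc _ t).
  by apply/eqP; rewrite eqn_leq tv vlt.
rewrite tE; apply: contrapT => gv; apply: (gv); apply: (@act_inj _ _ a g).
by apply: rg => -[_]; rewrite -(level_act a g v) anc_level.
Qed.

Lemma rist_below v w : below v w -> rist a w `<=` rist a v.
Proof.
move=> vw g /ristP rg; apply/ristP => t nvt; apply: rg => wt.
by apply: nvt; apply: below_trans wt.
Qed.

Definition fix_below w : set G := [set g | forall t, below w t -> a g t = t].

Lemma subgroup_fix_below w : subgroup (fix_below w).
Proof. exact: (subgroup_fix a [set t | below w t]). Qed.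

Lemma rist_fix_below v w : level v = level w -> v <> w ->
  rist a v `<=` fix_below w.
Proof.
move=> lvw nvw g /ristP rg t [wt wE]; apply: rg => -[vt vE].
by apply: nvw; rewrite -vE -wE lvw.
Qed.

(** The supports of [x] and [y] are disjoint. *)
Lemma rist_fix_below_commute w x y : rist a w x -> fix_below w y -> x * y = y * x.
Proof.
move=> /ristP rx fy; apply: faith; apply/funext => t; rewrite !actM.
have yw : a y w = w by apply: fy; apply: below_refl.
have [wt|nwt] := pselect (below w t); last first.
  by rewrite (rx t) // rx // -{1}yw below_actE.
have xw : below w (a x t).
  have [//|nxt] := pselect (below w (a x t)).
  by case: (nxt); rewrite (act_inj (rx _ nxt)).
by rewrite (fy t wt) (fy _ xw).
Qed.

Lemma rist_fix_below_trivial w x : rist a w x -> fix_below w x -> x = 1.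
Proof.
move=> /ristP rx fx; apply: act_trivial => t.
by have [/fx|/rx] := pselect (below w t).
Qed.

Lemma moves x n : x <> 1 -> exists t, (n <= level t)%N /\ a x t <> t.
Proof.
move=> x1; apply: contrapT => nm; apply: x1; apply: act_trivial => t.
have [w [[tw wE] wn]] := exists_below (leq_maxl (level t) n).
rewrite -wE act_anc; congr anc; apply: contrapT => nw; apply: nm.
by exists w; rewrite wn leq_maxr.
Qed.

Lemma moves_rist w x : rist a w x -> x <> 1 -> exists t, below w t /\ a x t <> t.
Proof.
move=> /ristP rx /(moves 0)[t [_ xt]]; exists t; split=> //.
by apply: contrapT => /rx.
Qed.

Lemma virt_rist_level n : virt_sub [set: G] (rist_level a n).
Proof.
have sR := subgroup_generated (\bigcup_(v in [set v : T | level v = n]) rist a v).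
case: n sR => [|n] sR; last first.
  apply/(finite_indexP sR (@subgroup_setT G)); rewrite setIT.
  by case: branch => _; apply.
apply: sub_virt => g _; apply: sub_generated; exists Defs.root; first exact: level_root.
apply/ristP => t; case; split; first by rewrite level_root.
by apply/level_eq0; rewrite level_root level_anc.
Qed.

(** By transitivity all rigid stabilizers of the level would be trivial, and the
    trivial group does not have finite index. *)
Lemma rist_nontrivial v : exists x, rist a v x /\ x <> 1.
Proof.
apply: contrapT => nx; apply: infinite.
apply: virt_subr (virt_rist_level (level v)) _.
apply: generated_sub; first exact: subgroup_set1.
move=> x [u uv ru]; apply: contrapT => x1.
have [g gu] := act_transitive (esym uv); apply: nx; exists (x ^ g); split.
  by have := ristJ (g := g) ru; rewrite -gu actK.
by move=> /eqP; rewrite conjg_eq1 => /eqP.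
Qed.

(** * Commutators in rigid stabilizers *)

Lemma rist_conj_fix_below w x y : rist a w x -> fix_below w y -> x ^ y = x.
Proof.
by move=> rx fy; rewrite conjgE (rist_fix_below_commute rx fy) mulKg.
Qed.

Lemma rist_conj_moved z t x : a z t <> t -> rist a t x -> fix_below t (x ^ z).
Proof.
move=> zt rx; apply: (rist_fix_below (v := a z^-1 t)); first by rewrite level_act.
  by move=> zt'; apply: zt; rewrite -{1}zt' actKV.
exact: ristJ.
Qed.

(** Since [x ^ z] is supported away from [t], the commutator [[~ x, z]] acts on
    the subtree below [t] as [x^-1] does. *)
Lemma double_commutator z t x y : a z t <> t -> rist a t x -> rist a t y ->
  [~ [~ x, z], y] = [~ x^-1, y].
Proof.
move=> zt rx ry; have fr := rist_conj_moved zt rx.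
have sR := subgroup_rist t.
have rw : rist a t (x * y^-1 * x^-1).
  have [rx' ry'] := (subgroupV sR rx, subgroupV sR ry).
  by apply: (subgroupM sR) => //; apply: (subgroupM sR).
have wE := rist_fix_below_commute rw fr.
rewrite [[~ x, z]]commgEl; set r := x ^ z in fr wE *.
have -> : [~ x^-1 * r, y] = r^-1 * (x * y^-1 * x^-1 * r) * y.
  by gsimp.
by rewrite wE; gsimp.
Qed.

Lemma commutator_moved_neq1 z t x :
  a z t <> t -> rist a t x -> x <> 1 -> [~ x, z] <> 1.
Proof.
move=> zt rx x1 cE; apply: x1; apply: (rist_fix_below_trivial rx).
suff -> : x = x ^ z by exact: rist_conj_moved.
by apply/esym; apply/eqP; rewrite conjg_fix cE.
Qed.

Definition rist' v : set G := derived (rist a v).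
Definition rist'' v : set G := derived (rist' v).

Lemma subgroup_rist' v : subgroup (rist' v). Proof. exact: subgroup_derived. Qed.

Lemma subgroup_rist'' v : subgroup (rist'' v). Proof. exact: subgroup_derived. Qed.

Lemma rist'_sub v : rist' v `<=` rist a v.
Proof. exact: derived_sub (subgroup_rist v). Qed.

Lemma rist''_sub v : rist'' v `<=` rist' v.
Proof. exact: derived_sub (subgroup_rist' v). Qed.

Lemma rist'_below v w : below v w -> rist' w `<=` rist' v.
Proof. by move=> vw; apply: derivedS; apply: rist_below. Qed.

Lemma rist''_below v w : below v w -> rist'' w `<=` rist'' v.
Proof. by move=> vw; apply: derivedS; apply: rist'_below. Qed.

Lemma rist'J v g x : rist' v x -> rist' (a g^-1 v) (x ^ g).
Proof. by move: x; apply: derivedJ => x; apply: ristJ. Qed.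

Lemma rist''J v g x : rist'' v x -> rist'' (a g^-1 v) (x ^ g).
Proof. by move: x; apply: derivedJ => x; apply: rist'J. Qed.

Lemma rist''_rist_conj v r x : rist a v r -> rist'' v x -> rist'' v (x ^ r).
Proof.
move=> rr; move: x; apply: derivedJ; apply: derivedJ => x rx.
exact: (subgroupJ (subgroup_rist v)).
Qed.

Lemma rist'_nontrivial v : exists x, rist' v x /\ x <> 1.
Proof.
have [z [rz z1]] := rist_nontrivial v; have [t [vt zt]] := moves_rist rz z1.
have [x [rx x1]] := rist_nontrivial t; exists [~ x, z]; split.
  by apply: mem_derived => //; apply: rist_below vt _ rx.
exact: commutator_moved_neq1 zt rx x1.
Qed.

Lemma rist''_nontrivial v : exists x, rist'' v x /\ x <> 1.
Proof.
have [z [rz z1]] := rist'_nontrivial v.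
have [t [vt zt]] := moves_rist (rist'_sub rz) z1.
have [x [rx x1]] := rist'_nontrivial t; exists [~ x, z]; split.
  by apply: mem_derived => //; apply: rist'_below vt _ rx.
exact: commutator_moved_neq1 zt (rist'_sub rx) x1.
Qed.

(** Grigorchuk's trick: a subgroup that moves [t] absorbs the commutators of
    its normalizer in [rist a t]. *)
Lemma derived_sub_of_moved (X Y : set G) z t :
  subgroup X -> subgroup Y -> X z -> a z t <> t -> Y `<=` rist a t ->
  (forall x y, X x -> Y y -> X (x ^ y)) -> derived Y `<=` X.
Proof.
move=> sX sY Xz zt Yt nX; apply: derived_min => // x y Yx Yy.
have Yx' := subgroupV sY Yx.
have <- : [~ [~ x^-1, z], y] = [~ x, y].
  by rewrite (double_commutator zt) ?invgK //; apply: Yt.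
have Xxz : X [~ x^-1, z].
  have -> : [~ x^-1, z] = (z^-1) ^ x^-1 * z by gsimp.
  by apply: (subgroupM sX) => //; apply: nX => //; apply: (subgroupV sX).
rewrite commgEl; apply: (subgroupM sX); first exact: (subgroupV sX).
exact: nX.
Qed.

(** With [Y] the whole rigid stabilizer, Grigorchuk's trick applies to any vertex
    moved by an element of a normal subgroup. *)
Lemma normal_contains_rist' N z n : normal_subgroup N -> N z -> z <> 1 ->
  exists t, (n <= level t)%N /\ rist' t `<=` N.
Proof.
move=> [sN nN] Nz /(moves n)[t [nt zt]]; exists t; split=> //.
by apply: (derived_sub_of_moved sN (subgroup_rist t) Nz zt) => // x y Nx _; apply: nN.
Qed.

Section FinitelyGenerated.
Hypothesis fg : fin_gen [set: G].

(** The subgroup [rist_level] is finitely generated by Schreier's lemma, and it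
    suffices to keep those generators that lie in [rist a w] among finitely many
    elements of rigid stabilizers: the others commute with [rist a w] and do not
    contribute to it. *)
Lemma fin_gen_rist w : fin_gen (rist a w).
Proof.
set n := level w.
have [s [sU sE]] := fin_gen_finite_support
  (fin_gen_finite_index fg (subgroup_generated _) (virt_rist_level n)).
pose s' := [seq x <- s | `[< rist a w x >]].
have sR := subgroup_rist w; have sF := subgroup_fix_below w.
have sg' := subgroup_generated [set` s'].
have s'R : generated [set` s'] `<=` rist a w.
  by apply: generated_sub => // x /=; rewrite mem_filter => /andP[/asboolP].
exists s'; apply/seteqP; split=> // r rr.
pose X : set G := [set g | exists2 x, generated [set` s'] x & fix_below w (x^-1 * g)].
have sX : subgroup X.
  split=> [|g h [x gx fx] [y gy fy]|g [x gx fx]].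
  - by exists 1; [apply: subgroup1|rewrite mulg1 invg1; apply: subgroup1].
  - exists (x * y); first exact: (subgroupM sg').
    have -> : (x * y)^-1 * (g * h) = y^-1 * (x^-1 * g) * y * (y^-1 * h) by gsimp.
    apply: (subgroupM sF) => //.
    have -> : y^-1 * (x^-1 * g) * y = x^-1 * g.
      by rewrite -mulgA -(rist_fix_below_commute (s'R _ gy) fx) mulKg.
    by [].
  - exists x^-1; first exact: (subgroupV sg').
    have -> : x^-1^-1 * g^-1 = ((x^-1 * g)^-1) ^ x^-1 by gsimp.
    rewrite conjgE -(rist_fix_below_commute _ (subgroupV sF fx)).
      by rewrite mulKg; apply: (subgroupV sF).
    by apply: (subgroupV sR); apply: s'R.
have sub : rist_level a n `<=` X.
  apply: subset_trans sE _; apply: generated_sub => // c sc.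
  have [v vn rc] := sU c sc.
  have [vw|vw] := pselect (v = w).
    exists c; last by rewrite mulVg; apply: subgroup1.
    apply: sub_generated => /=; rewrite mem_filter sc andbT; apply/asboolP.
    by rewrite -vw.
  exists 1; first exact: subgroup1.
  by rewrite invg1 mul1g; apply: rist_fix_below rc.
have [x gx fx] : X r by apply: sub; apply: sub_generated; exists w.
have x1 : x^-1 * r = 1.
  apply: rist_fix_below_trivial fx; apply: (subgroupM sR) => //.
  by apply: (subgroupV sR); apply: s'R.
by rewrite -(mulVKg x r) x1 mulg1.
Qed.

(** A substitute for finite generation of [rist'' u]: the commutators [[~ x^-1, z]]
    with a fixed element [z] of [rist'' u] act below a vertex [t] moved by [z] like
    the generators [x] of [rist a t], so finitely many elements of [rist'' u]
    suffice to generate all of [rist' t]. *)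
Lemma fin_gen_between u : exists t (s : seq G),
  [set` s] `<=` rist'' u /\ rist' t `<=` generated [set` s].
Proof.
have [z [rz z1]] := rist''_nontrivial u.
have [t [ut zt]] := moves_rist (rist'_sub (rist''_sub rz)) z1.
have [s sE] := fin_gen_rist t.
pose c x := [~ x^-1, z].
pose B := map c s ++ [seq [~ c x, y] | x <- s, y <- s].
have sR := subgroup_rist t; have sgB := subgroup_generated [set` B].
have sRs x : x \in s -> rist a t x.
  by move=> xs; rewrite sE; apply: sub_generated.
have tu := rist_below ut.
have sD := subgroup_rist'' u.
have cD x : x \in s -> rist'' u (c x).
  move=> /sRs rx; have -> : c x = (z^-1) ^ x^-1 * z by rewrite /c; gsimp.
  apply: (subgroupM sD) => //; apply: rist''_rist_conj; last exact: (subgroupV sD).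
  by apply: tu; apply: (subgroupV sR).
exists t, B; split.
  move=> b /=; rewrite mem_cat => /orP[/mapP[x xs ->]|/allpairsP[[x y] /= [xs ys ->]]].
    exact: cD.
  rewrite commgEl; apply: (subgroupM sD); first exact: (subgroupV sD (cD x xs)).
  by apply: rist''_rist_conj; [apply: tu; apply: sRs|apply: cD].
pose K := generated [set` B] `&` rist a t.
have sK : subgroup K by apply: subgroup_setI.
have lift r : rist a t r -> exists2 f, generated [set` B] f & fix_below t (r^-1 * f).
  have sF := subgroup_fix_below t.
  suff: generated [set` s] `<=` [set r | rist a t r /\
      exists2 f, generated [set` B] f & fix_below t (r^-1 * f)].
    by rewrite -sE => sub /sub[].
  apply: generated_sub => [|x /= xs]; last first.
    split; first exact: sRs.
    exists (c x); first by apply: sub_generated; rewrite /= mem_cat map_f.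
    have -> : x^-1 * c x = x^-1 ^ z by rewrite /c; gsimp.
    by apply: rist_conj_moved => //; apply: (subgroupV sR); apply: sRs.
  split=> [|x y [rx [f gf fx]] [ry [h gh fy]]|x [rx [f gf fx]]].
  - split; first exact: (subgroup1 sR).
    by exists 1; [apply: (subgroup1 sgB)|rewrite mulVg; apply: (subgroup1 sF)].
  - split; first exact: (subgroupM sR).
    exists (f * h); first exact: (subgroupM sgB).
    have -> : (x * y)^-1 * (f * h) = y^-1 * ((x^-1 * f) * y) * (y^-1 * h) by gsimp.
    rewrite -(rist_fix_below_commute ry fx) mulKg.
    exact: (subgroupM sF).
  - split; first exact: (subgroupV sR).
    exists f^-1; first exact: (subgroupV sgB).
    have -> : x^-1^-1 * f^-1 = x * ((x^-1 * f)^-1 * x^-1) by gsimp.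
    have fx' := subgroupV sF fx.
    rewrite -(rist_fix_below_commute (subgroupV sR rx) fx').
    by rewrite mulVKg.
have nK r x : generated [set` s] r -> K x -> K (x ^ r).
  rewrite -sE => rr [gx rx]; split; last exact: (subgroupJ sR).
  have [f gf fr] := lift r rr.
  have -> : x ^ r = x ^ f.
    by rewrite -(mulVKg r f) conjgM (rist_conj_fix_below _ fr) //; apply: (subgroupJ sR).
  exact: (subgroupJ sgB).
have Kc x y : [set` s] x -> [set` s] y -> K [~ x, y].
  move=> /= xs ys; split; last by apply: (subgroupR sR); apply: sRs.
  have <- : [~ c x, y] = [~ x, y].
    rewrite /c (double_commutator zt) ?invgK //; last exact: sRs.
    by apply: (subgroupV sR); apply: sRs.
  apply: sub_generated; rewrite /= mem_cat; apply/orP; right.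
  by apply/allpairsP; exists (x, y).
apply: derived_min => // x y; rewrite sE => gx gy.
by have [] := commutators_of_generators sK nK Kc gx gy.
Qed.

(** * Infinite and ample commensurated subgroups *)

Lemma residually_finite (s : seq G) :
  exists m, forall x, x \in s -> level_stab a m x -> x = 1.
Proof.
elim: s => [|y s [m mP]]; first by exists 0%N.
have [->|y1] := pselect (y = 1).
  by exists m => x; rewrite inE => /orP[/eqP->//|]; apply: mP.
have [t [_ yt]] := moves 0 y1.
exists (maxn m (level t)) => x; rewrite inE => /orP[/eqP->|xs] sx.
  by case: yt; apply: sx; apply: leq_maxr.
by apply: mP => //; apply: level_stabS sx; apply: leq_maxl.
Qed.

Lemma commensurated_pt_stab H g :
  subgroup H -> commensurated H -> virt_sub (pt_stab H g) H.
Proof.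
move=> sH /(commensuratedP sH)/(_ g^-1)/(virt_pt_stab g).
by rewrite pt_stabM mulgV pt_stab1.
Qed.

(** If [H] met the rigid stabilizers of some level trivially, then for [x] in
    such a rigid stabilizer and [g] in a finite index subgroup of [H] the
    commutator of [x] and [g] would be trivial.  As rigid stabilizers are finitely
    generated, a finite index subgroup of [H] would centralize all of them, and
    hence be trivial. *)
Lemma infinite_commensurated_meets_rist H : subgroup H -> commensurated H ->
  ~ virt_sub H [set 1] -> forall v, ~ virt_sub (H `&` rist a v) [set 1].
Proof.
move=> sH cH' infH v0 fin0; have cH := (commensuratedP sH).1 cH'.
set n0 := level v0 in fin0.
have fin v : level v = n0 -> virt_sub (H `&` rist a v) [set 1].
  move=> vn; have [g gv] := act_transitive (esym vn).
  have sR := subgroup_rist v.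
  have : virt_sub (H `&` rist a v) (pt_stab (H `&` rist a v0) g).
    apply: (virt_subr (H := pt_stab H g `&` rist a v)); last first.
      by rewrite -gv -pt_stab_rist.
    apply: virt_setI => //; first exact: subgroup_pt_stab.
      by apply: virt_subl (cH g) => x [].
    by apply: sub_virt => x [].
  move/virt_trans; apply; apply: virt_subr (virt_pt_stab g fin0) _ => x.
  by rewrite /pt_stab /= => /eqP; rewrite conjg_eq1 => /eqP.
have [vs vsP] := finite_level lfT n0.
have [s sP] : exists s : seq G, forall v, level v = n0 ->
    forall x, (H `&` rist a v) x -> x \in s.
  suff [s sP] : exists s : seq G, forall v : {classic T}, v \in vs ->
      forall x, (H `&` rist a v) x -> x \in s.
    by exists s => v /vsP; apply: sP.
  have : forall v : {classic T}, v \in vs -> level v = n0 by move=> v /vsP.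
  elim: {vsP} vs => [|v vs IH] vsP; first by exists [::].
  have [|s sP] := IH; first by move=> w wvs; apply: vsP; rewrite inE wvs orbT.
  have [|s' s'P] := fin v; first by apply: vsP; rewrite inE eqxx.
  exists (s' ++ s) => w; rewrite inE => /orP[/eqP->|wvs] x Hx; rewrite mem_cat.
    have [c cs' c1] := s'P x Hx.
    by rewrite -(mulVKg c x) c1 mulg1 cs'.
  by rewrite (sP w wvs) ?orbT.
have [m1 m1P] := residually_finite s; pose m := maxn m1 n0.
have triv w : level w = m -> forall x, H x -> rist a w x -> x = 1.
  move=> wm x Hx rx; apply: m1P.
    have n0w : (n0 <= level w)%N by rewrite wm leq_maxr.
    apply: (sP (anc n0 w)); first exact: level_anc.
    by split=> //; apply: rist_below rx; apply: below_anc.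
  by apply: (level_stabS (n := m)); [apply: leq_maxl|rewrite -wm; apply: rist_level_stab].
pose C x : set G := [set g | x ^ g = x].
have sC x : subgroup (C x).
  split=> [|g h|g]; rewrite /C /= ?conjg1 //.
    by move=> xg xh; rewrite conjgM xg.
  by move=> xg; rewrite -{1}xg conjgK.
have HC w x : level w = m -> rist a w x -> virt_sub H (C x).
  move=> wm rx; have sS := subgroup_level_stab a m.
  have sHx := subgroup_pt_stab x^-1 sH.
  have : virt_sub H (H `&` (pt_stab H x^-1 `&` level_stab a m)).
    apply: virt_setI => //; [exact: subgroup_setI|exact: sub_virt|].
    apply: virt_setI => //.
    exact: virt_subl (@subsetT _ H) (virt_level_stab a lfT m).
  move/virt_subr; apply=> g [Hg [Hgx sg]]; rewrite /C /=.
  have gw : a g w = w by apply: sg; rewrite wm.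
  have rE : g ^ x^-1 * g^-1 = 1.
    apply: (triv w wm); first exact: (subgroupM sH Hgx (subgroupV sH Hg)).
    have -> : g ^ x^-1 * g^-1 = x * (x^-1) ^ g^-1 by gsimp.
    apply: (subgroupM (subgroup_rist w)) => //.
    by rewrite -{1}gw -{1}(invgK g); apply/ristJ/(subgroupV (subgroup_rist w)).
  have gE : g = g ^ x^-1 by rewrite -[RHS](mulgVK g) rE mul1g.
  have : g * x = x * g by rewrite {1}gE; gsimp.
  by rewrite conjgE => <-; rewrite mulKg.
have [ws wsP] := finite_level lfT m.
have [S SP] : exists S : seq G, (forall x, x \in S -> virt_sub H (C x)) /\
    forall w, level w = m -> rist a w `<=` generated [set` S].
  suff [S [S1 S2]] : exists S : seq G, (forall x, x \in S -> virt_sub H (C x)) /\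
      forall w : {classic T}, w \in ws -> rist a w `<=` generated [set` S].
    by exists S; split=> // w /wsP; apply: S2.
  have : forall w : {classic T}, w \in ws -> level w = m by move=> w /wsP.
  elim: {wsP} ws => [|w ws IH] wsP; first by exists [::].
  have [|S [S1 S2]] := IH; first by move=> v vws; apply: wsP; rewrite inE vws orbT.
  have [S' S'E] := fin_gen_rist w; exists (S' ++ S); split.
    move=> x; rewrite mem_cat => /orP[xS'|/S1//]; apply: (HC w).
      by apply: wsP; rewrite inE eqxx.
    by rewrite S'E; apply: sub_generated.
  move=> v; rewrite inE => /orP[/eqP->|vws].
    by rewrite S'E; apply: generatedS => x /= xS'; rewrite mem_cat xS'.
  apply: subset_trans (S2 v vws) _; apply: generatedS => x /= xS.
  by rewrite mem_cat xS orbT.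
apply: infH.
have : virt_sub H (\bigcap_(x in [set` S]) C x).
  by apply: virt_bigcap => x xS; [apply: sC|apply: SP.1].
move/virt_subr; apply=> g gC /=; apply: contrapT => /(moves m)[t [mt gt]].
have [x [rx x1]] := rist_nontrivial t; apply: x1.
apply: (rist_fix_below_trivial rx).
have /(_ x) xg : generated [set` S] `<=` [set x | x ^ g = x].
  apply: generated_sub => [|y yS]; last exact: gC.
  split=> [|y z|y]; rewrite /= ?conj1g //.
    by move=> yg zg; rewrite conjMg yg zg.
  by move=> yg; rewrite conjVg yg.
suff <- : x ^ g = x by exact: rist_conj_moved.
apply: xg; apply: (SP.2 (anc m t)); first exact: level_anc.
by apply: rist_below rx; apply: below_anc.
Qed.

Lemma normal_generated_level (F : T -> set G) n :
  (forall v g x, F v x -> F (a g^-1 v) (x ^ g)) ->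
  normal_subgroup (generated (\bigcup_(v in [set v : T | level v = n]) F v)).
Proof.
move=> FJ; split=> [|x g]; first exact: subgroup_generated.
move: x; apply: pt_stab_generated => x [v vn Fx].
by exists (a g^-1 v); [rewrite /= level_act|apply: FJ].
Qed.

(** For [u] of level [n], this is the normal closure of [rist'' u]. *)
Definition rist''_level n : set G :=
  generated (\bigcup_(v in [set v : T | level v = n]) rist'' v).

Lemma normal_rist''_level n : normal_subgroup (rist''_level n).
Proof. by apply: normal_generated_level => v g x; apply: rist''J. Qed.

Lemma rist''_sub_level n t : (n <= level t)%N -> rist'' t `<=` rist''_level n.
Proof.
move=> nt x rx; apply: sub_generated; exists (anc n t); first exact: level_anc.
by apply: rist''_below rx; apply: below_anc.
Qed.

(** The subgroups [rist'' v] for [v] of the level of [u] are conjugate, so each of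
    them is virtually contained in [H]; there are finitely many of them, and they
    commute. *)
Lemma virt_rist''_level H u : subgroup H -> commensurated H ->
  rist'' u `<=` H -> virt_sub (rist''_level (level u)) H.
Proof.
move=> sH cH uH; set n := level u.
have vF v : level v = n -> virt_sub (rist'' v) H.
  move=> vn; have [g gu] := act_transitive (esym vn).
  apply: virt_subl (commensurated_pt_stab g sH cH) => x /(rist''J (g := g)).
  by rewrite -gu actK => /uH.
have [vs vsP] := finite_level lfT n.
pose gen (ws : seq {classic T}) := generated (\bigcup_(v in [set` ws]) rist'' v).
suff main (ws : seq {classic T}) : uniq ws ->
    (forall v : {classic T}, v \in ws -> level v = n) -> virt_sub (gen ws) H.
  apply: virt_subl (main (undup vs) (undup_uniq _) _).
    by apply: generatedS => x [v vn rx]; exists v => //=; rewrite mem_undup; apply/vsP.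
  by move=> v; rewrite mem_undup => /vsP.
elim: ws => [|v ws IH] /=.
  move=> _ _; apply: sub_virt; apply: generated_sub => // x [w].
  by rewrite /= in_nil.
move=> /andP[vws uws] wsn.
have /(_ uws) vgen := IH _; have {}vgen : virt_sub (gen ws) H.
  by apply: vgen => w www; apply: wsn; rewrite inE www orbT.
have vn : level v = n by apply: wsn; rewrite inE eqxx.
have sg := subgroup_generated (\bigcup_(v in [set` ws]) rist'' v).
have sv := subgroup_rist'' v.
have gfix : gen ws `<=` fix_below v.
  apply: generated_sub; first exact: subgroup_fix_below.
  move=> x [w /= www rx]; apply: (rist_fix_below (v := w)).
  - by rewrite vn; apply: wsn; rewrite inE www orbT.
  - by move=> wv; move/negP: vws; rewrite -wv; apply.
  - by apply: rist'_sub; apply: rist''_sub.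
have comm x y : rist'' v x -> gen ws y -> x * y = y * x.
  move=> rx gy; apply: (rist_fix_below_commute (w := v)); last exact: gfix.
  by apply: rist'_sub; apply: rist''_sub.
have dec : gen (v :: ws) `<=` [set x | exists y z, [/\ rist'' v y, gen ws z & x = y * z]].
  apply: generated_sub => [|x [w /= ]]; last first.
    rewrite inE => /orP[/eqP-> rx|www rx].
      by exists x, 1; split; rewrite ?mulg1 //; apply: (subgroup1 sg).
    exists 1, x; split; rewrite ?mul1g //; first exact: (subgroup1 sv).
    by apply: sub_generated; exists w.
  split=> [|x y [x1 [x2 [rx gx ->]]] [y1 [y2 [ry gy ->]]]|x [x1 [x2 [rx gx ->]]]].
  - by exists 1, 1; split; rewrite ?mulg1 //; [apply: (subgroup1 sv)|apply: (subgroup1 sg)].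
  - exists (x1 * y1), (x2 * y2); split.
    + exact: (subgroupM sv).
    + exact: (subgroupM sg).
    + by rewrite mulgA -[x1 * x2 * y1]mulgA -(comm y1 x2) // !mulgA.
  - exists x1^-1, x2^-1; split.
    + exact: (subgroupV sv).
    + exact: (subgroupV sg).
    + by rewrite invgM (comm x1^-1) //; [apply: (subgroupV sv)|apply: (subgroupV sg)].
have [s [sv' sP]] := virt_subP sH vgen; have [t tP] := vF v vn.
exists [seq d * c | d <- s, c <- t] => _ /dec[y [z [ry gz ->]]].
have [d ds Hd] := sP z gz; have [c ct Hc] := tP y ry.
exists (d * c); first by apply/allpairsP; exists (d, c).
have -> : (d * c)^-1 * (y * z) = (c^-1 * y) * (d^-1 * z).
  have gd : gen ws d^-1 by apply: (subgroupV sg); apply: sv'.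
  by rewrite invgM -!mulgA; congr (_ * _); rewrite !mulgA (comm y).
exact: (subgroupM sH).
Qed.

(** Modulo the normal subgroup generated by the [rist' v] of a deep level, the
    group is virtually abelian; in a virtually abelian group a commensurated
    subgroup has, up to finite index, finitely many conjugates. *)
Lemma commensurate_to_normal_of_rist'' H u : subgroup H -> commensurated H ->
  rist'' u `<=` H -> exists N, normal_subgroup N /\ commensurate H N.
Proof.
move=> sH cH uH; have [sN nN] := normal_rist''_level (level u).
set N := rist''_level (level u) in sN nN.
have vN : virt_sub N H by apply: virt_rist''_level.
have [z [rz z1]] := rist''_nontrivial u.
have Nz : N z by apply: (@rist''_sub_level (level u) u).
have [t [_ tN]] := normal_contains_rist' 0 (conj sN nN) Nz z1.
set n := level t; set R := rist_level a n.
pose N' := generated (\bigcup_(v in [set v : T | level v = n]) rist' v).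
have [sN' nN'] : normal_subgroup N'.
  by apply: normal_generated_level => v g x; apply: rist'J.
have N'N : N' `<=` N.
  apply: generated_sub => // x [v vn rx].
  have [g gt] := act_transitive (esym vn : level t = level v).
  rewrite -(conjgK g x); apply: nN; apply: tN.
  by have := rist'J (g := g) rx; rewrite -gt actK.
have sR : subgroup R by apply: subgroup_generated.
have RN' x y : R x -> R y -> N' [~ x, y].
  apply: commutators_of_generators => [//|r k _|b c [v vn rb] [w wn rc]].
    exact: nN'.
  have [vw|vw] := pselect (v = w).
    by apply: sub_generated; exists v => //; apply: mem_derived => //; rewrite vw.
  have -> : [~ b, c] = 1.
    apply/eqP/commgP; apply: (rist_fix_below_commute rb).
    by apply: rist_fix_below rc => [|wv]; rewrite ?wn ?vn //; apply: vw.
  exact: (subgroup1 sN').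
pose H1 : set G := [set x | exists2 h, H h & N (h^-1 * x)].
have sH1 : subgroup H1.
  split=> [|x y [h Hh Nx] [k Hk Ny]|x [h Hh Nx]].
  - by exists 1; [apply: (subgroup1 sH)|rewrite mulVg; apply: (subgroup1 sN)].
  - exists (h * k); first exact: (subgroupM sH).
    have -> : (h * k)^-1 * (x * y) = (h^-1 * x) ^ k * (k^-1 * y) by gsimp.
    by apply: (subgroupM sN) => //; apply: nN.
  - exists h^-1; first exact: (subgroupV sH).
    have -> : h^-1^-1 * x^-1 = ((h^-1 * x) ^ h^-1)^-1 by gsimp.
    by apply: (subgroupV sN); apply: nN.
have HH1 : H `<=` H1.
  by move=> x Hx; exists x => //; rewrite mulVg; apply: (subgroup1 sN).
have NH1 : N `<=` H1.
  by move=> x Nx; exists 1; [apply: (subgroup1 sH)|rewrite invg1 mul1g].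
have vH1 : virt_sub H1 H.
  have [s sP] := vN; exists s => x [h Hh Nx].
  have [c cs Hc] := sP _ (nN _ h^-1 Nx); exists c => //.
  have -> : c^-1 * x = (c^-1 * (h^-1 * x) ^ h^-1) * h by gsimp.
  exact: (subgroupM sH).
pose H2 := H1 `&` R.
have sH2 : subgroup H2 by apply: subgroup_setI.
have vH2 : virt_sub H H2.
  apply: virt_setI => //; first exact: sub_virt.
  exact: virt_subl (@subsetT _ H) (virt_rist_level n).
have H2R r : R r -> pt_stab H2 r = H2.
  have sub x r' : R r' -> H2 x -> H2 (x ^ r').
    move=> Rr' [H1x Rx]; split; last exact: (subgroupJ sR).
    rewrite -(mulVKg x (x ^ r')) -commgEl; apply: (subgroupM sH1) => //.
    by apply: NH1; apply: N'N; apply: RN'.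
  move=> Rr; apply/seteqP; split=> x; rewrite /pt_stab /=; last exact: sub.
  by move=> /(sub _ r^-1 (subgroupV sR Rr)); rewrite conjgK.
pose M := \bigcap_(g in [set: G]) pt_stab H2 g.
have sM : subgroup M.
  by apply: subgroup_bigcap => g _; apply: subgroup_pt_stab.
have nM : normal_subgroup M.
  split=> // x g Mx h _; have := Mx (g * h) I.
  by rewrite /pt_stab /= conjgM.
have vHM : virt_sub H M.
  have [s sP] := virt_rist_level n.
  have : virt_sub H (\bigcap_(c in [set` s]) pt_stab H2 c).
    apply: virt_bigcap => c _; first exact: subgroup_pt_stab.
    exact: virt_trans ((commensuratedP sH).1 cH c) (virt_pt_stab c vH2).
  move/virt_subr; apply=> x Mx g _; have [c cs Rc] := sP g I.
  by rewrite -(mulVKg c g) -pt_stabM H2R //; apply: Mx.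
exists M; split=> //; apply/(commensurateP sH sM); split=> //.
apply: virt_subl vH1 => x /(_ 1 I).
by rewrite pt_stab1 => -[].
Qed.

(** For commensurated subgroups this is equivalent to containing a nontrivial normal
    subgroup of [G] up to finite index.  With the second derived subgroup, strict
    containment suffices throughout: it can be detected on a finitely generated
    subgroup by [fin_gen_between], and the trick of [derived_sub_of_moved] leads
    back to it from a subgroup normalized by some [rist' t]. *)
Definition ample H : Prop := exists u, rist'' u `<=` H.

Lemma ample_of_normal H N z : normal_subgroup N -> N z -> z <> 1 -> N `<=` H ->
  ample H.
Proof.
move=> nN Nz z1 NH; have [t [_ tN]] := normal_contains_rist' 0 nN Nz z1.
by exists t => x /rist''_sub /tN /NH.
Qed.

(** Zorn's lemma applies because ampleness of the union of a chain is witnessed by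
    the finitely many elements given by [fin_gen_between], which lie in one member
    of the chain. *)
Lemma maximal_not_ample H0 : subgroup H0 -> ~ ample H0 ->
  exists H, [/\ subgroup H, uniform_ext H0 H, ~ ample H &
    forall K, subgroup K -> uniform_ext H K -> ~ ample K -> K `<=` H].
Proof.
move=> sH0 nH0.
(* taking the union with [H0] makes the empty chain harmless *)
pose P (A : set G) := [/\ subgroup (H0 `|` A), uniform_ext H0 (H0 `|` A) &
                          ~ ample (H0 `|` A)].
have P0 : P set0 by split; rewrite setU0 //; apply: uniform_ext_refl.
have [F FP chainF|A [[sA uA nA] Amax]] := @Zorn_bigcup G P.
  pose U := H0 `|` \bigcup_(X in F) X.
  have chain (s : seq G) : [set` s] `<=` U -> exists A, [/\ P A, H0 `|` A `<=` U &
      [set` s] `<=` H0 `|` A].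
    suff : [set` s] `<=` U -> exists2 A, A = set0 \/ F A & [set` s] `<=` H0 `|` A.
      move=> sub sU; have [A AF sA] := sub sU; exists A; split=> //.
        by case: AF => [->//|]; apply: FP.
      move=> x [|Ax]; first by left.
      by case: AF Ax => [->//|FA Ax]; right; exists A.
    elim: s => [|x s IH] sU; first by exists set0; [left|].
    have [|A AF sA] := IH; first by move=> y ys; apply: sU; rewrite /= inE (ys : y \in s) orbT.
    have {sA}cons B : A `<=` B -> (H0 `|` B) x -> [set` x :: s] `<=` H0 `|` B.
      move=> AB Bx y /=; rewrite inE => /orP[/eqP->//|/sA[|/AB]]; first by left.
      by right.
    have [H0x|[X FX Xx]] : U x by apply: sU; rewrite /= inE eqxx.
      by exists A => //; apply: cons => //; left.
    case: AF => [A0|FA].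
      by exists X; [right|apply: cons; [rewrite A0|right]].
    have [AX|XA] := chainF A X FA FX.
      by exists X; [right|apply: cons => //; right].
    by exists A; [right|apply: cons => //; right; apply: XA].
  rewrite /P -/U; split.
  - split.
    + by left; apply: subgroup1 sH0.
    + move=> x y Ux Uy; have [|A [[sA _ _] AU sub]] := chain [:: x; y].
        by move=> z /=; rewrite !inE => /orP[]/eqP->.
      by apply: AU; apply: (subgroupM sA); apply: sub; rewrite /= !inE eqxx ?orbT.
    + move=> x Ux; have [|A [[sA _ _] AU sub]] := chain [:: x].
        by move=> z /=; rewrite !inE => /eqP->.
      by apply: AU; apply: (subgroupV sA); apply: sub; rewrite /= !inE eqxx.
  - split=> [|g x Ux]; first by move=> x; left.
    have [|A [[sA [_ uA] _] AU sub]] := chain [:: x].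
      by move=> z /=; rewrite !inE => /eqP->.
    have [|h Hh Ah] := uA g x; first by apply: sub; rewrite /= inE eqxx.
    by exists h => //; apply: pt_stabS AU _ Ah.
  - move=> [u uU]; have [t [s [su ts]]] := fin_gen_between u.
    have [|A [[sA _ nA] AU sub]] := chain s; first by move=> x /su /uU.
    apply: nA; exists t => x /rist''_sub /ts; move: x.
    exact: generated_sub.
exists (H0 `|` A); split=> // K sK uK nK x Kx; apply: contrapT => nx.
have HK : H0 `|` A `<=` K by case: uK.
have KE : H0 `|` K = K.
  by apply/seteqP; split=> y; [case=> // H0y; apply: HK; left|right].
apply: (Amax K).
  by split=> [y Ay|KA]; [apply: HK; right|apply: nx; right; apply: KA].
by split; rewrite KE //; apply: uniform_ext_trans uA uK.
Qed.

Lemma infinite_neq1 (K : set G) : ~ virt_sub K [set 1] -> exists x, K x /\ x <> 1.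
Proof.
move=> infK; apply: contrapT => nx; apply: infK; apply: sub_virt => x Kx.
by apply: contrapT => x1; apply: nx; exists x.
Qed.

Lemma normal_of_generators (S : seq G) (M : set G) : [set: G] = generated [set` S] ->
  subgroup M -> (forall s x, s \in S ++ [seq s^-1 | s <- S] -> M x -> M (x ^ s)) ->
  normal_subgroup M.
Proof.
move=> SE sM MS; split=> // x g Mx.
suff : [set: G] `<=` [set g | forall x, M x -> M (x ^ g) /\ M (x ^ g^-1)].
  by move=> /(_ g I) /(_ x Mx)[].
rewrite SE; apply: generated_sub => [|s /= sS y My]; last first.
  by split; apply: MS => //; rewrite mem_cat ?sS // map_f ?orbT.
split=> [y My|h k hM kM y My|h hM y My].
- by rewrite invg1 conjg1.
- rewrite invgM !conjgM; split; first exact: (kM _ (hM y My).1).1.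
  exact: (hM _ (kM y My).2).2.
- by rewrite invgK; have [] := hM y My.
Qed.

Lemma exists_level n : exists v : T, level v = n.
Proof.
have [|v [_ vn]] := @exists_below Defs.root n; first by rewrite level_root.
by exists v.
Qed.

(** * The two limit extensions *)

Section Stable.
Variable H : set G.
Hypotheses (sH : subgroup H) (cH : commensurated H).
Hypothesis infH : ~ virt_sub H [set 1].

Let stab_system (_ : unit) n := level_stab a n.

Lemma limit_system_stab : limit_system stab_system.
Proof.
have sS n := subgroup_level_stab a n; split.
- by move=> [] m n; apply: level_stabS.
- by exists tt => n; apply: subgroup1 (sS n).
- by move=> [] []; exists tt => n x y; apply: (subgroupM (sS n)).
- by move=> []; exists tt => n x; apply: (subgroupV (sS n)).
- by move=> [] g; exists tt => n x; apply: level_stabJ.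
Qed.

(** The closure of [H] in the topology of the levels of the tree. *)
Definition level_closure : set G := limit_ext stab_system H.

(** Fixing a deep level, elements of [H] also fix the points [s H] for [s] in a
    finite symmetric generating set.  So they form a subgroup that is normalized by
    all generators. *)
Lemma ample_of_level_closed : level_closure `<=` H -> ample H.
Proof.
move=> closed; have [S SE] := fg.
have [n nP] : exists n, forall s, s \in S ++ [seq s^-1 | s <- S] ->
    level_stab a n `&` H `<=` pt_stab H s.
  apply: eventually_all => [s m n mn sub x [sx Hx]|s _].
    by apply: sub; split=> //; apply: level_stabS mn _ sx.
  have [n nP] := limit_ext_stable limit_system_stab sH cH closed tt s.
  by exists n.
have [v vn] := exists_level n.
have [x [[Hx rx] x1]] :=
  infinite_neq1 (infinite_commensurated_meets_rist sH cH infH (v := v)).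
pose M := level_stab a n `&` H.
have sM : subgroup M by apply: subgroup_setI => //; apply: subgroup_level_stab.
apply: (@ample_of_normal H M x) => //; last by move=> y [].
  apply: (normal_of_generators SE) => // s y sS My; split; last exact: nP My.
  by apply: level_stabJ; case: My.
by split=> //; rewrite -vn; apply: rist_level_stab.
Qed.

(** The part of the stabilizer of the point [e H] that is carried by the
    individual subtrees of level [n]. *)
Definition local_part e n : set G :=
  generated (\bigcup_(v in [set v : T | level v = n]) (pt_stab H e `&` rist a v)).

Fixpoint local_prod (E : seq G) n : set G :=
  if E is e :: E' then
    [set x | exists p q, [/\ local_part e n p, local_prod E' n q & x = p * q]]
  else [set 1].

Lemma subgroup_local_part e n : subgroup (local_part e n).
Proof. exact: subgroup_generated. Qed.

Lemma local_part_sub e n : local_part e n `<=` pt_stab H e.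
Proof.
by apply: generated_sub => [|x [v _ []]] //; apply: subgroup_pt_stab.
Qed.

Lemma local_partS e m n : (m <= n)%N -> local_part e n `<=` local_part e m.
Proof.
move=> mn; apply: generatedS => x [v /= vn [Hx rx]].
have mv : (m <= level v)%N by rewrite vn.
exists (anc m v); first exact: level_anc.
by split=> //; apply: rist_below rx; apply: below_anc.
Qed.

Lemma local_partJ e n g x : local_part e n x -> local_part (g^-1 * e) n (x ^ g).
Proof.
move: x; apply: pt_stab_generated => x [v vn [Hx rx]].
exists (a g^-1 v); first by rewrite /= level_act.
by split; [rewrite /pt_stab /= -conjgM mulVKg|apply: ristJ].
Qed.

Lemma local_prodS E m n : (m <= n)%N -> local_prod E n `<=` local_prod E m.
Proof.
move=> mn; elim: E => [|e E IH] //= x [p [q [pe qE ->]]].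
by exists p, q; split=> //; [apply: local_partS mn _ pe|apply: IH].
Qed.

Lemma local_prod_cat E E' n x y :
  local_prod E n x -> local_prod E' n y -> local_prod (E ++ E') n (x * y).
Proof.
elim: E x => [|e E IH] x /=; first by move=> ->; rewrite mul1g.
move=> [p [q [pe qE ->]]] yE'; exists p, (q * y); split=> //; first exact: IH.
by rewrite mulgA.
Qed.

Lemma local_prod1 e n x : local_part e n x -> local_prod [:: e] n x.
Proof. by move=> xe; exists x, 1; rewrite mulg1. Qed.

Lemma local_prodV E n x : local_prod E n x -> local_prod (rev E) n x^-1.
Proof.
elim: E x => [|e E IH] x /=; first by move=> ->; rewrite invg1.
move=> [p [q [pe qE ->]]]; rewrite rev_cons -cats1 invgM.
apply: local_prod_cat; first exact: IH.
by apply: local_prod1; apply: (subgroupV (subgroup_local_part e n)).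
Qed.

Lemma local_prodJ E n g x :
  local_prod E n x -> local_prod [seq g^-1 * e | e <- E] n (x ^ g).
Proof.
elim: E x => [|e E IH] x /=; first by move=> ->; rewrite conj1g.
move=> [p [q [pe qE ->]]]; exists (p ^ g), (q ^ g); split; last exact: conjMg.
  exact: local_partJ.
exact: IH.
Qed.

Lemma limit_system_local : limit_system local_prod.
Proof.
split.
- by move=> E m n; apply: local_prodS.
- by exists [::].
- by move=> E E'; exists (E ++ E') => n x y; apply: local_prod_cat.
- by move=> E; exists (rev E) => n x; apply: local_prodV.
- by move=> E g; exists [seq g^-1 * e | e <- E] => n x; apply: local_prodJ.
Qed.

(** Products of local parts for different [e] are needed to make the system, hence
    this extension, invariant under conjugation. *)
Definition local_closure : set G := limit_ext local_prod H.

(** As for [ample_of_level_closed], with [local_part 1 n] as normal subgroup. *)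
Lemma ample_of_local_closed : local_closure `<=` H -> ample H.
Proof.
move=> closed; have [S SE] := fg.
have [n nP] : exists n, forall s, s \in S ++ [seq s^-1 | s <- S] ->
    local_prod [:: 1] n `&` H `<=` pt_stab H s.
  apply: eventually_all => [s m n mn sub x [sx Hx]|s _].
    by apply: sub; split=> //; apply: local_prodS mn _ sx.
  have [n nP] := limit_ext_stable limit_system_local sH cH closed [:: 1] s.
  by exists n.
have [v vn] := exists_level n.
have [x [[Hx rx] x1]] :=
  infinite_neq1 (infinite_commensurated_meets_rist sH cH infH (v := v)).
have LH : local_part 1 n `<=` H by rewrite -[X in _ `<=` X]pt_stab1; apply: local_part_sub.
apply: (@ample_of_normal H (local_part 1 n) x) => //.
  apply: (normal_of_generators SE) => [|s y sS]; first exact: subgroup_local_part.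
  move: y; apply: pt_stab_generated => y [w wn [Hy ry]].
  exists (a s^-1 w); first by rewrite /= level_act.
  split; last exact: ristJ.
  rewrite pt_stab1; apply: nP sS _ _; rewrite pt_stab1 in Hy; split=> //.
  apply: local_prod1; apply: sub_generated; exists w => //.
  by split=> //; rewrite pt_stab1.
by apply: sub_generated; exists v => //; split=> //; rewrite pt_stab1.
Qed.

(** * Large orbits and commutation in the limit *)

(** A normal subgroup that contains some [rist'' u] has large orbits on all deep
    levels: an element of [rist'' v] that moves a vertex [t] below [v] makes the
    orbit of [t] larger than that of [v]. *)
Lemma large_orbits_rist''_level m K : exists n0, forall n, (n0 <= n)%N ->
  forall v, level v = n -> exists s : seq G, [/\ size s = K,
    forall x, x \in s -> rist''_level m x &
    uniq [seq (a x v : {classic T}) | x <- 1 :: s]].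
Proof.
have [sN nN] := normal_rist''_level m.
elim: K => [|K [n0 IH]]; first by exists 0%N => n _ v _; exists [::].
pose n1 := maxn n0 m; have [v1 v1n] := exists_level n1.
have [s [sK sN' us]] := IH n1 (leq_maxl _ _) v1 v1n.
have [z [rz z1]] := rist''_nontrivial v1.
have rz' : rist a v1 z by apply: rist'_sub; apply: rist''_sub.
have [t [v1t zt]] := moves_rist rz' z1.
have Nz : rist''_level m z.
  by apply: rist''_sub_level rz; rewrite v1n leq_maxr.
have n1t : (n1 <= level t)%N by rewrite -v1n; case: v1t.
have anct : anc n1 t = v1 by rewrite -v1n; case: v1t.
have zv1 : a z v1 = v1 by apply: rist_level_stab rz' _ _.
exists (level t) => n tn v vn.
have [g gt] : exists g, a g t = anc (level t) v.
  by apply: act_transitive; rewrite level_anc // vn.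
exists [seq x ^ g^-1 | x <- z :: s]; split; first by rewrite size_map /= sK.
  by move=> x /mapP[y]; rewrite inE => /orP[/eqP->|/sN' Ny] ->; apply: nN.
have ut : uniq [seq (a x t : {classic T}) | x <- 1 :: z :: s].
  move: us; rewrite /= !act1 => /andP[v1s us].
  pose anc1 : {classic T} -> {classic T} := anc n1.
  have ancs : map anc1 [seq (a x t : {classic T}) | x <- s] =
              [seq (a x v1 : {classic T}) | x <- s].
    by rewrite -map_comp; apply: eq_map => x; rewrite /= /anc1 -act_anc anct.
  have nots x : anc n1 (a x t) = v1 ->
      (a x t : {classic T}) \notin [seq (a x t : {classic T}) | x <- s].
    move=> xt; apply/negP => /(map_f anc1).
    by rewrite ancs /anc1 xt; apply/negP.
  rewrite inE negb_or -[X in X \notin [seq _ | _ <- s]](act1 a t) !nots ?act1 //.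
  - rewrite !andbT; apply/andP; split; first by apply/eqP => zt'; apply: zt.
    by move: us; rewrite -ancs => /map_uniq.
  - by rewrite -act_anc anct.
(* [f] carries the translates of [v] back to those of [t] *)
pose f (w : {classic T}) : {classic T} := a g^-1 (anc (level t) w).
have fE x : f (a (x ^ g^-1) v) = a x t.
  by rewrite /f -act_anc -gt conjgE invgK !actM !actK.
rewrite (_ : 1 :: _ = [seq x ^ g^-1 | x <- 1 :: z :: s]); last by rewrite /= conj1g.
apply: (@map_uniq _ _ f); rewrite -!map_comp.
by rewrite (eq_map (g := fun x => a x t : {classic T})).
Qed.

(** On each level [level_closure] has the orbits of [H], and it virtually contains
    a normal subgroup with large orbits. *)
Lemma large_orbits : ample level_closure -> forall K, exists n0,
  forall n, (n0 <= n)%N -> forall v, level v = n ->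
  exists t : seq {classic T}, [/\ uniq t, (K <= size t)%N &
    forall u, u \in t -> exists2 h, H h & a h v = u].
Proof.
move=> [u uL] K.
have sL : subgroup level_closure := subgroup_limit_ext limit_system_stab sH.
have cL : commensurated level_closure.
  apply: uniform_ext_commensurated sH sL _ cH.
  exact: uniform_limit_ext limit_system_stab sH cH.
have [s sP] := virt_rist''_level sL cL uL.
have [n0 n0P] := large_orbits_rist''_level (level u) (size s * K).
exists n0 => n /n0P{}n0P v /[dup] vn /n0P[r [szr rN ur]].
pose P c x := `[< level_closure (c^-1 * x) >].
have [c cs cK] : exists2 c, c \in s & (K <= count (P c) (1%g :: r))%N.
  apply: contrapT => nc.
  have : (size (1%g :: r) <= \sum_(c <- s) count (P c) (1%g :: r))%N.
    apply: size_le_cover => x xr.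
    have [|c cs Lc] := sP x; last by exists c => //; apply/asboolP.
    move: xr; rewrite inE => /orP[/eqP->|/rN//].
    by apply: subgroup1; apply: subgroup_generated.
  rewrite leqNgt => /negP; apply; rewrite /= szr ltnS.
  apply: leq_trans (_ : \sum_(c <- s) K <= _)%N.
    rewrite big_seq [X in (_ <= X)%N]big_seq; apply: leq_sum => c cs.
    by rewrite leqNgt; apply/negP => /ltnW cK; apply: nc; exists c.
  by rewrite big_const_seq count_predT iter_addn_0 mulnC.
pose t := [seq (a (c^-1 * x) v : {classic T}) | x <- 1 :: r & P c x].
exists t; split.
- rewrite /t (_ : map _ _ = map (fun w : {classic T} => a c^-1 w : {classic T})
     [seq (a x v : {classic T}) | x <- 1 :: r & P c x]).
    rewrite map_inj_uniq; last by move=> w w' /act_inj.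
    by apply: subseq_uniq ur; apply: map_subseq; apply: filter_subseq.
  by rewrite -map_comp; apply: eq_map => x /=; rewrite actM.
- by rewrite size_map size_filter.
- move=> w /mapP[x]; rewrite mem_filter => /andP[/asboolP[i iP] _] ->.
  have [p sp Hp] := iP n; exists (p^-1 * (c^-1 * x)) => //.
  rewrite actM; have sp' := subgroupV (subgroup_level_stab a n) sp.
  by rewrite (sp' (a _ v)) // level_act vn.
Qed.

Lemma virt_pt_stab_pt_stab e y : virt_sub (pt_stab H e) (pt_stab H y).
Proof.
exact: virt_trans (commensurated_pt_stab e sH cH) ((commensuratedP sH).1 cH y).
Qed.

Lemma local_part_conj e n h x :
  pt_stab H e h -> local_part e n x -> local_part e n (x ^ h).
Proof.
move=> Hh; move: x; apply: pt_stab_generated => x [v vn [Hx rx]].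
exists (a h^-1 v); first by rewrite /= level_act.
by split; [apply: (subgroupJ (subgroup_pt_stab e sH))|apply: ristJ].
Qed.

(** This is commensuration, read in the coset space. *)
Lemma finite_orbit e y : exists s : seq G, y \in s /\
  forall h, pt_stab H e h -> exists2 z, z \in s & same_pt H z (h * y).
Proof.
have [s sP] := virt_pt_stab_pt_stab e y.
exists (y :: [seq c * y | c <- s]); rewrite inE eqxx; split=> // h Hh.
have [c cs Hc] := sP h Hh; exists (c * y); first by rewrite inE (map_f (fun d => d * y)) ?orbT.
by move/pt_stabE: Hc; rewrite /same_pt; gsimp.
Qed.

(** The group [pt_stab H e] acts on its orbits of points through finite quotients,
    and the bound [k] depends only on one of these quotients: on the given points,
    the local parts of all levels act like elements carried by [k] subtrees. *)
Lemma small_support e (Y : seq G) : exists k, exists W : set G,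
  [/\ subgroup W, forall h, pt_stab H e h -> pt_stab W h = W,
      forall x y, W x -> y \in Y -> pt_stab H y x &
      forall n, exists J : seq {classic T}, [/\ (size J <= k)%N,
        forall v : {classic T}, v \in J -> level v = n &
        forall p, local_part e n p -> exists2 q,
          generated (\bigcup_(v in [set` J]) (pt_stab H e `&` rist a v)) q &
          W (q^-1 * p)]].
Proof.
have sK := subgroup_pt_stab e sH.
have vY : virt_sub (pt_stab H e) (\bigcap_(y in [set` Y]) pt_stab H y).
  apply: virt_bigcap => y _; first exact: subgroup_pt_stab.
  exact: virt_pt_stab_pt_stab.
have sY : subgroup (\bigcap_(y in [set` Y]) pt_stab H y).
  by apply: subgroup_bigcap => y _; apply: subgroup_pt_stab.
have [W [sW WY [s sP] nW]] := virt_core sK sY vY.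
exists (size s), W; split=> // [x y /WY + yY|n]; first exact.
have [J [Js Jn JP]] := @bounded_support G {classic T} [set v : {classic T} | level v = n]
  (fun v => pt_stab H e `&` rist a v) _ _ _ sK sW nW sP (fun v _ x => @proj1 _ _).
by exists J.
Qed.

Section Commutation.
Hypothesis large : forall K, exists n0, forall n, (n0 <= n)%N ->
  forall v, level v = n -> exists t : seq {classic T}, [/\ uniq t, (K <= size t)%N &
    forall u, u \in t -> exists2 h, H h & a h v = u].

(** On a given point, the elements [p] and [q] act like elements of small support,
    and as orbits are large, conjugating [p] makes these supports disjoint. *)
Lemma local_part_commute e e' y : exists n, forall p q,
  local_part e n p -> local_part e' n q -> same_pt H (p * q * y) (q * p * y).
Proof.
have [Y [yY YP]] := finite_orbit e y; have [Y' [yY' Y'P]] := finite_orbit e' y.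
have [k [W [sW nW WY supp]]] := small_support e Y'.
have [k' [W' [sW' nW' W'Y supp']]] := small_support e' Y.
have [n largen] := large (k * k').+1.
have [J [Jk Jn JP]] := supp n; have [J' [J'k J'n J'P]] := supp' n.
exists n => p q pe qe'.
have sK := subgroup_pt_stab e sH.
have [l Kl lJ] : exists2 l, pt_stab H e l &
    forall v : {classic T}, v \in J -> (a l v : {classic T}) \notin J'.
  have [vs vsP] := finite_level lfT n.
  apply: (@disjoint_translate G {classic T} a (@act1 _ _ a) (@actM _ _ a) _ vs) => //.
  - by move=> h v _ /vsP vn; apply/vsP; rewrite level_act.
  - by move=> v vJ; apply/vsP/Jn.
  - by move=> v vJ; apply/vsP/J'n.
  move=> v vJ; have [|t [ut szt tP]] := largen n (leqnn n) (a e^-1 v).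
    by rewrite level_act Jn.
  exists (map (fun u : {classic T} => a e u : {classic T}) t); split.
  - by rewrite map_inj_uniq // => u u'; apply: act_inj.
  - by rewrite size_map; apply: leq_trans szt; rewrite ltnS leq_mul.
  - move=> u /mapP[w /tP[h Hh hw] ->]; exists (h ^ e^-1).
      by rewrite /pt_stab /= conjgKV.
    by rewrite conjgE invgK !actM hw.
have [q1 gq1 Wq1] := JP _ (local_part_conj Kl pe).
pose p1 := q1 ^ l^-1.
have Kl' := subgroupV sK Kl.
have Wp1 : W (p1^-1 * p).
  have -> : p1^-1 * p = (q1^-1 * p ^ l) ^ l^-1 by rewrite /p1; gsimp.
  by have : pt_stab W l^-1 (q1^-1 * p ^ l) by rewrite nW.
have [p2 gp2 Wp2] := J'P _ qe'.
have sg2 := subgroup_generated (\bigcup_(v in [set` J']) (pt_stab H e' `&` rist a v)).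
have p12 : p1 * p2 = p2 * p1.
  have fixJ (v : {classic T}) : v \in J -> fix_below (a l v) p2.
    move=> vJ; move: p2 gp2 {Wp2}; apply: generated_sub; first exact: subgroup_fix_below.
    move=> x [w /= wJ' [_ rx]]; apply: rist_fix_below rx.
      by rewrite level_act (Jn v vJ) (J'n w wJ').
    by move=> wl; have := lJ v vJ; rewrite -wl => /negP; apply.
  suff /(_ q1 gq1) : generated (\bigcup_(v in [set` J]) (pt_stab H e `&` rist a v)) `<=`
      [set x | (x ^ l^-1) ^ p2 = x ^ l^-1].
    by rewrite /= -/p1 => {2}<-; rewrite -conjgC.
  apply: generated_sub => [|x [v /= vJ [_ rx]]].
    split=> [|x z xE zE|x xE]; first by rewrite /= !conj1g.
      by rewrite /= (conjMg x) (conjMg (x ^ _)) xE zE.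
    by rewrite /= (conjVg x) (conjVg (x ^ _)) xE.
  apply: (rist_conj_fix_below (w := a l v)); last exact: fixJ.
  by have := ristJ (g := l^-1) rx; rewrite invgK.
have K'p2 : pt_stab H e' p2.
  by move: p2 gp2 {Wp2 p12}; apply: generated_sub => [|x [v _ []]] //; apply: subgroup_pt_stab.
have Kp1 : pt_stab H e p1.
  apply: (subgroupJ sK) => //.
  by move: q1 gq1 {Wq1 p1 Wp1 p12}; apply: generated_sub => // x [v _ []].
(* the finite sets [Y] and [Y'] contain all the points that are met here *)
have replace r r1 s (Z : seq G) V : (forall x z, V x -> z \in Z -> pt_stab H z x) ->
    V (r1^-1 * r) -> (exists2 z, z \in Z & same_pt H z (s * y)) ->
    same_pt H (r * (s * y)) (r1 * (s * y)).
  move=> VZ Vr [z zZ zs].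
  have -> : r * (s * y) = r1 * (r1^-1 * r * (s * y)) by gsimp.
  apply/same_ptM; apply: (same_pt_sym sH).
  suff : pt_stab H (s * y) (r1^-1 * r) by move/pt_stabE.
  by rewrite -(pt_stab_same sH zs); apply: VZ.
have rp s : pt_stab H e' s -> same_pt H (p * (s * y)) (p1 * (s * y)).
  by move=> Ks; apply: (replace _ _ _ Y' W) => //; apply: Y'P.
have rq s : pt_stab H e s -> same_pt H (q * (s * y)) (p2 * (s * y)).
  by move=> Ks; apply: (replace _ _ _ Y W') => //; apply: YP.
have K1 := subgroup1 sK; have K'1 := subgroup1 (subgroup_pt_stab e' sH).
have rp1 := rp 1 K'1; have rq1 := rq 1 K1; rewrite !mul1g in rp1 rq1.
rewrite -!mulgA.
apply: (same_pt_trans (y := p1 * (p2 * y)) sH).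
  apply: (same_pt_trans sH _ (rp p2 K'p2)); exact/same_ptM.
rewrite [p1 * _]mulgA p12 -[p2 * _ * _]mulgA; apply: (same_pt_sym sH).
apply: (same_pt_trans sH _ (rq p1 Kp1)); exact/same_ptM.
Qed.

Lemma local_prod_finite_orbit E y : exists s : seq G, forall n p,
  local_prod E n p -> exists2 z, z \in s & same_pt H z (p * y).
Proof.
elim: E => [|e E [s sP]].
  exists [:: y] => n p ->; exists y; rewrite ?inE // mul1g.
  exact: same_pt_refl.
pose f z := xget [::] [set t : seq G | forall h, pt_stab H e h ->
  exists2 u, u \in t & same_pt H u (h * z)].
exists (flatten [seq f z | z <- s]) => n _ [p [q [pe qE ->]]].
have [z zs zq] := sP n q qE.
have [u uf up] : exists2 u, u \in f z & same_pt H u (p * z).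
  have [t [_ tP]] := finite_orbit e z.
  apply: (@xgetPex _ [::] [set t : seq G | forall h, pt_stab H e h ->
    exists2 u, u \in t & same_pt H u (h * z)]); first by exists t.
  exact: local_part_sub pe.
exists u; first by apply/flattenP; exists (f z) => //; apply: map_f.
apply: (same_pt_trans sH up); rewrite -mulgA; exact/same_ptM.
Qed.

(** Commutation passes to products because the second factor moves a point to
    finitely many points only, whatever the level. *)
Lemma local_prod_commute E E' y : exists n, forall p q,
  local_prod E n p -> local_prod E' n q -> same_pt H (p * q * y) (q * p * y).
Proof.
pose commuting E E' := forall y, exists n, forall p q,
  local_prod E n p -> local_prod E' n q -> same_pt H (p * q * y) (q * p * y).
have commS E1 E2 : commuting E1 E2 -> commuting E2 E1.
  move=> comm z; have [n nP] := comm z; exists n => p q pE qE.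
  by apply: (same_pt_sym sH); apply: nP.
have cons e E1 E2 : commuting [:: e] E2 -> commuting E1 E2 -> commuting (e :: E1) E2.
  move=> comm1 comm2 z; have [s sP] := local_prod_finite_orbit E1 z.
  have [n2 n2P] := comm2 z.
  have [n1 n1P] : exists n, forall x, x \in s -> forall p q, local_prod [:: e] n p ->
      local_prod E2 n q -> same_pt H (p * q * x) (q * p * x).
    apply: eventually_all => [x m n mn sub p q pe qE|x _]; last exact: comm1.
    by apply: sub; [apply: local_prodS mn _ pe|apply: local_prodS mn _ qE].
  exists (maxn n1 n2) => _ q [p1 [p2 [p1e p2E ->]]] qE2.
  have [u us up2] := sP _ _ p2E.
  have q1 := local_prodS (leq_maxl n1 n2) qE2.
  have q2 := local_prodS (leq_maxr n1 n2) qE2.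
  have p1' := local_prodS (leq_maxl n1 n2) (local_prod1 p1e).
  have p2' := local_prodS (leq_maxr n1 n2) p2E.
  have c2 := n2P _ _ p2' q2; have c1 := n1P u us _ _ p1' q1.
  apply: (same_pt_trans (y := p1 * (q * p2 * z)) sH).
    by rewrite -[p1 * p2 * q * z]mulgA -!mulgA; apply/same_ptM; rewrite !mulgA.
  apply: (same_pt_trans (y := p1 * q * u) sH).
    rewrite -!mulgA; do 2 apply/same_ptM; exact: (same_pt_sym sH).
  apply: (same_pt_trans sH c1); rewrite -!mulgA; do 2 apply/same_ptM.
  exact: up2.
have nil E1 : commuting [::] E1.
  move=> z; exists 0%N => p q -> _; rewrite mulg1 mul1g; exact: same_pt_refl.
have single e e' : commuting [:: e] [:: e'].
  move=> z; have [n nP] := local_part_commute e e' z.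
  exists n => _ _ [p [_ [pe -> ->]]] [q [_ [qe -> ->]]].
  by rewrite !mulg1; apply: nP.
have single_l e E1 : commuting [:: e] E1.
  apply: (commS); elim: E1 => [|e' E1 IH]; first exact: nil.
  exact: cons.
suff comm E1 : commuting E1 E' by exact: comm.
by elim: E1 => [|e E1 IH]; [apply: nil|apply: cons].
Qed.

End Commutation.

(** * Ampleness of infinite commensurated subgroups *)

(** The finite index subgroup [W] of [H] fixes the points [b H] for the generators
    [b] of a subgroup [F] of [local_closure].  If [W] also fixes [g H], write
    [b H = p H] and [b g H = p q H] with [p] and [q] in the limit of the local
    parts.  Conjugation by [l] in [W] replaces [p] by [p k] with [k] fixing the base
    point, and [k] disappears from [p k q H] because it commutes with [q].  So [W]
    fixes the whole orbit of the base point under [F]. *)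
Lemma ample_of_ample_closures :
  ample level_closure -> ample local_closure -> ample H.
Proof.
move=> /large_orbits large [u uL].
have [t [s [su ts]]] := fin_gen_between u.
have sC : subgroup local_closure := subgroup_limit_ext limit_system_local sH.
pose s' := s ++ [seq b^-1 | b <- s].
have s'C b : b \in s' -> local_closure b.
  rewrite mem_cat => /orP[bs|/mapP[c cs ->]]; first by apply: uL; apply: su.
  by apply: (subgroupV sC); apply: uL; apply: su.
have [W [sW WH vW nW]] : exists W : set G, [/\ subgroup W,
    W `<=` H `&` \bigcap_(b in [set` s']) pt_stab H b, virt_sub H W &
    forall h, H h -> pt_stab W h = W].
  have ss : subgroup (\bigcap_(b in [set` s']) pt_stab H b).
    by apply: subgroup_bigcap => b _; apply: subgroup_pt_stab.
  apply: virt_core => //; first exact: subgroup_setI.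
  apply: virt_setI => //; first exact: sub_virt.
  apply: virt_bigcap => b _; first exact: subgroup_pt_stab.
  exact: (commensuratedP sH).1 cH b.
pose fixed : set G := [set g | local_closure g /\ forall l, W l -> pt_stab H g l].
have step b g : b \in s' -> fixed g -> fixed (b * g).
  move=> bs [Cg Wg]; split=> [|l Wl]; first exact: (subgroupM sC (s'C b bs)).
  have [Eb bE] := s'C b bs.
  have [sg [_ sgP]] := finite_orbit 1 g; rewrite pt_stab1 in sgP.
  (* the approximation [p] of [b] is only determined up to elements of [H], but
     [p^-1 * b * g] takes finitely many values modulo [H], so that [c] can be
     chosen independently of the order [n] *)
  pose Q c n := exists p, [/\ local_prod Eb n p, H (p^-1 * b) &
                              same_pt H c (p^-1 * b * g)].
  have [c csg cQ] : exists2 c, c \in sg & forall n, Q c n.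
    apply: stable_pigeonhole => [c m n mn [p [pE Hp cp]]|n].
      by exists p; split=> //; apply: local_prodS mn _ pE.
    have [p pE Hp] := bE n; have [c cs cp] := sgP _ Hp.
    by exists c => //; exists p.
  have [Cc Wc] : fixed c.
    have [p [_ Hp cp]] := cQ 0%N; set h := p^-1 * b in Hp cp.
    have cp' := same_pt_sym sH cp; split=> [|k Wk].
      rewrite -(mulVKg (h * g) c); apply: (subgroupM sC).
        by apply: (subgroupM sC) => //; apply: sub_limit_ext limit_system_local _ Hp.
      exact: sub_limit_ext limit_system_local _ (cp' : H ((h * g)^-1 * c)).
    rewrite (pt_stab_same sH cp) -pt_stabM; apply: Wg.
    by have : pt_stab W h k by rewrite nW.
  have [Ec cE] := Cc.
  have [n nP] := local_prod_commute large
    (rev Eb ++ [seq l^-1^-1 * e | e <- Eb]) Ec 1.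
  have [p [pE Hp cp]] := cQ n; have [q qE Hq] := cE n.
  pose k := p^-1 * p ^ l^-1.
  have kE : local_prod (rev Eb ++ [seq l^-1^-1 * e | e <- Eb]) n k.
    by apply: local_prod_cat; [apply: local_prodV|apply: local_prodJ].
  have := nP k q kE qE; rewrite !mulg1 => comm.
  have Hk : same_pt H 1 k.
    have -> : k = l ^ p * l^-1 by rewrite /k; gsimp.
    have [Hl /(_ b bs)] := WH l Wl.
    rewrite -[pt_stab H b](pt_stab_same sH (Hp : same_pt H p b)) => Hlp.
    by rewrite /same_pt invg1 mul1g; apply: (subgroupM sH Hlp); apply: (subgroupV sH).
  have qbg : same_pt H (p * q) (b * g).
    apply: (same_pt_trans (y := p * c) sH); first exact/same_ptM.
    apply: (same_pt_trans (y := p * (p^-1 * b * g)) sH); first exact/same_ptM.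
    by rewrite !mulgA mulgV mul1g; apply: same_pt_refl.
  apply/pt_stabE; apply: (same_pt_trans sH (same_pt_sym sH qbg)).
  apply: (same_pt_trans (y := l * (p * q)) sH); last exact/same_ptM.
  have -> : l * (p * q) = p * (k * (l * q)) by rewrite /k; gsimp.
  apply/same_ptM; apply: (same_pt_trans (y := k * q) sH).
    apply: (same_pt_trans _ _ (same_pt_sym sH comm)) => //.
    by rewrite -{1}[q]mulg1; apply/same_ptM.
  apply/same_ptM; apply: (same_pt_trans sH Hq).
  apply: (same_pt_trans (y := l * c) sH); first by move/pt_stabE: (Wc l Wl).
  by apply/same_ptM; apply: same_pt_sym sH Hq.
have fixed1 : fixed 1.
  split=> [|l /WH[]]; first exact: (subgroup1 sC).
  by rewrite pt_stab1.
have sF := subgroup_generated [set` s].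
have Ffixed : generated [set` s] `<=` fixed.
  suff sub : generated [set` s] `<=` [set f | (forall g, fixed g -> fixed (f * g)) /\
      (forall g, fixed g -> fixed (f^-1 * g))].
    by move=> f /sub[/(_ 1 fixed1) + _]; rewrite mulg1.
  apply: generated_sub => [|b /= bs].
    split=> [|f h [f1 f2] [h1 h2]|f [f1 f2]]; split=> g Zg.
    - by rewrite mul1g.
    - by rewrite invg1 mul1g.
    - by rewrite -mulgA; apply: f1; apply: h1.
    - by rewrite invgM -mulgA; apply: h2; apply: f2.
    - exact: f2.
    - by rewrite invgK; apply: f1.
  by split=> g; apply: step; rewrite mem_cat ?bs // map_f ?orbT.
pose Z := \bigcap_(f in generated [set` s]) pt_stab H f.
have sZ : subgroup Z.
  by apply: subgroup_bigcap => f _; apply: subgroup_pt_stab.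
have WZ : W `<=` Z by move=> l Wl f /Ffixed[_]; apply.
have [x [[Wx rx] x1]] : exists x, (W `&` rist a t) x /\ x <> 1.
  apply: infinite_neq1 => fin.
  apply: (infinite_commensurated_meets_rist sH cH infH (v := t)).
  apply: virt_trans fin; apply: virt_setI => //; first exact: subgroup_rist.
    by apply: virt_subl vW => y [].
  by apply: sub_virt => y [].
have [t' [tt' xt']] := moves_rist rx x1.
exists t'; apply: (subset_trans (B := Z)); last first.
  by move=> y /(_ 1 (subgroup1 sF)); rewrite pt_stab1.
apply: (derived_sub_of_moved sZ (subgroup_rist' t') (WZ _ Wx) xt').
  exact: rist'_sub.
move=> z y Zz ry f Ff.
have Fy : generated [set` s] y by apply: ts; apply: rist'_below tt' _ ry.
have := Zz _ (subgroupM sF Fy Ff).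
by rewrite /pt_stab /= conjgM.
Qed.

End Stable.

(** In a maximal counterexample each limit extension is either equal to the
    subgroup or ample, and both alternatives make the subgroup ample. *)
Lemma infinite_commensurated_ample H : subgroup H -> commensurated H ->
  ~ virt_sub H [set 1] -> ample H.
Proof.
move=> sH cH infH; apply: contrapT => nH.
have [K [sK uK nK maxK]] := maximal_not_ample sH nH.
have cK : commensurated K := uniform_ext_commensurated sH sK uK cH.
have infK : ~ virt_sub K [set 1].
  by move=> vK; apply: infH; apply: virt_subl vK; case: uK.
apply: (nK); apply: ample_of_ample_closures => //; apply: contrapT => nC.
  apply: (nK); apply: ample_of_level_closed => //; apply: maxK nC => //.
    exact: subgroup_limit_ext limit_system_stab sK.
  exact: uniform_limit_ext limit_system_stab sK cK.
apply: nK; apply: ample_of_local_closed => //; apply: maxK nC => //.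
  by apply: subgroup_limit_ext sK; apply: limit_system_local.
by apply: uniform_limit_ext sK cK; apply: limit_system_local.
Qed.

End FinitelyGenerated.
End Branch.

Theorem theorem1p6 (G : groupType) :
  finitely_generated G -> branch_group G ->
  forall H : set G, subgroup H -> commensurated H ->
    exists N : set G, normal_subgroup N /\ commensurate H N.
Proof.
move=> [S [finS SE]] [T [a [lfT faith branch]]] H sH cH.
have [vH|infH] := pselect (virt_sub H [set 1]).
  exists [set 1]; split.
    split; first exact: subgroup_set1.
    by move=> x g ->; rewrite /= conj1g.
  apply/(commensurateP sH (@subgroup_set1 G)); split=> //.
  by apply: sub_virt => x ->; apply: (subgroup1 sH).
have inf : ~ virt_sub [set: G] [set 1].
  by move=> vG; apply: infH; apply: virt_subl vG.
have fg : fin_gen [set: G].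
  by move: finS SE => /finite_seqP[s ->] SE; exists s.
have [u uH] := infinite_commensurated_ample lfT faith branch inf fg sH cH infH.
exact: (commensurate_to_normal_of_rist'' lfT faith branch inf sH cH uH).
Qed.
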